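(* Let $Q$ be a connected quiver and $\Lambda=kQ/\langle Z\rangle$ a finite dimensional monomial algebra such that $L_{-1}=k(Q_1//Q_0)\cap\operatorname{Ker}\psi_1=0$. The following are equivalent: (i) the Lie algebra $\operatorname{H}^1(\Lambda,\Lambda)$ is semisimple; (ii) the quiver $\bar Q$ is a tree, $Q$ has at least one class of parallel arrows with at least two arrows, the ideal $\langle Z\rangle$ is completely saturated, and, if $\operatorname{char}k=2$, $Q$ has no class of parallel arrows containing exactly two arrows; (iii) $\operatorname{H}^1(\Lambda,\Lambda)$ is nonzero and isomorphic to $\prod_{\bar\alpha}\mathfrak{pgl}(|\bar\alpha|,k)$, the product over all classes of parallel arrows $\bar\alpha$, where $|\bar\alpha|\neq2$ for all $\bar\alpha$ if $\operatorname{char}k=2$.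
   Context: $k$ is an algebraically closed field, $Q$ a finite quiver; $Q_n$ = paths of length $n$ ($Q_0$ vertices, $Q_1$ arrows). $Z$ is a minimal set of paths of length $\ge2$ (no proper subpath of an element of $Z$ lies in $Z$), $\Lambda=kQ/\langle Z\rangle$ finite dimensional; $B$ = paths (vertices included) containing no element of $Z$ as subpath. Paths are parallel if they have the same source and terminus; $X//Y$ = pairs of parallel paths in $X\times Y$; $k(X//Y)$ the vector space with that basis. For a path $\varepsilon$ and $(a,\gamma)\in Q_1//B$, $\varepsilon^{(a,\gamma)}$ = sum of all paths in $B$ obtained by replacing one occurrence of $a$ in $\varepsilon$ by $\gamma$ ($0$ if none); $(\eta,\varepsilon^{(a,\gamma)})=\sum_i(\eta,\varepsilon_i)$ if $\varepsilon^{(a,\gamma)}=\sum_i\varepsilon_i$. $\psi_1:k(Q_1//B)\to k(Z//B)$, $(a,\gamma)\mapsto\sum_{p\in Z}(p,p^{(a,\gamma)})$. $\operatorname{H}^1(\Lambda,\Lambda)$ = derivations modulo inner derivations, commutator bracket. Classes of parallel arrows are the equivalence classes of parallelism on $Q_1$. $\bar Q$ is the subquiver of $Q$ with all vertices and one chosen representative arrow of every class of parallel arrows (a tree = underlying unoriented graph is a tree). The ideal $\langle Z\rangle$ is completely saturated if for every pair of parallel arrows $(a,b)$ and every $p\in Z$ one has $p^{(b,a)}=0$. $\mathfrak{pgl}(n,k)=\mathfrak{gl}(n,k)/k\cdot1$. *)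

(* Defs.v *)
From mathcomp Require Import all_boot all_algebra.
Set Implicit Arguments. Unset Strict Implicit. Unset Printing Implicit Defensive.
Import GRing.Theory.
Local Open Scope ring_scope.

(* Quotient Lie algebras S/I given by representatives.                      *)
(* A [lieq k] packages a carrier with (raw) vector space operations and a   *)
(* bracket, a predicate S (a Lie algebra of representatives) and a          *)
(* predicate I (the ideal that is quotiented out). It denotes the Lie       *)
(* algebra S/I.  Sub-objects of S/I are subspaces J with I <= J <= S.       *)
Record lieq (k : fieldType) := LieQ {
  lq_car : Type;
  lq_add : lq_car -> lq_car -> lq_car;
  lq_scale : k -> lq_car -> lq_car;
  lq_zero : lq_car;
  lq_br : lq_car -> lq_car -> lq_car;
  lq_S : lq_car -> Prop;
  lq_I : lq_car -> Prop }.
Arguments lq_car {k} l.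
Arguments lq_add {k} l _ _.
Arguments lq_scale {k} l _ _.
Arguments lq_zero {k} l.
Arguments lq_br {k} l _ _.
Arguments lq_S {k} l _.
Arguments lq_I {k} l _.

Section LieQ.
Variables (k : fieldType) (L : lieq k).
Local Notation T := (lq_car L).

Definition lq_sub (x y : T) : T := lq_add L x (lq_scale L (-1) y).

Definition lq_subspace (W : T -> Prop) : Prop :=
  [/\ W (lq_zero L), (forall x y, W x -> W y -> W (lq_add L x y))
    & (forall c x, W x -> W (lq_scale L c x))].

Definition lq_ideal (J : T -> Prop) : Prop :=
  [/\ lq_subspace J, (forall x, lq_I L x -> J x), (forall x, J x -> lq_S L x)
    & (forall x y, lq_S L x -> J y -> J (lq_br L x y))].

Definition lq_derived (J : T -> Prop) : T -> Prop :=
  fun z => forall W : T -> Prop, lq_subspace W -> (forall x, lq_I L x -> W x) ->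
    (forall x y, J x -> J y -> W (lq_br L x y)) -> W z.

Definition lq_solvable (J : T -> Prop) : Prop :=
  exists n, forall z, iter n lq_derived J z -> lq_I L z.

Definition lq_nonzero : Prop := exists x, lq_S L x /\ ~ lq_I L x.

Definition lq_semisimple : Prop :=
  lq_nonzero /\
  forall J, lq_ideal J -> lq_solvable J -> forall x, J x -> lq_I L x.
End LieQ.
Arguments lq_sub {k} L _ _.

Definition lq_iso (k : fieldType) (L1 L2 : lieq k) : Prop :=
  exists phi : lq_car L1 -> lq_car L2,
  [/\ forall x, lq_S L1 x -> lq_S L2 (phi x),
      forall x y, lq_S L1 x -> lq_S L1 y ->
        lq_I L2 (lq_sub L2 (phi (lq_add L1 x y)) (lq_add L2 (phi x) (phi y))) /\
      forall c x, lq_S L1 x ->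
        lq_I L2 (lq_sub L2 (phi (lq_scale L1 c x)) (lq_scale L2 c (phi x))),
      forall x y, lq_S L1 x -> lq_S L1 y ->
        lq_I L2 (lq_sub L2 (phi (lq_br L1 x y)) (lq_br L2 (phi x) (phi y))),
      forall x, lq_S L1 x -> (lq_I L2 (phi x) <-> lq_I L1 x)
    & forall y, lq_S L2 y -> exists2 x, lq_S L1 x & lq_I L2 (lq_sub L2 (phi x) y)].

(* A path is a pair (v, s): s = [:: a1; ...; an] arrows with                *)
(* tgt a_i = src a_(i+1) and v = src a1; the trivial path e_v is (v, [::]). *)
Definition qpath (V A : Type) := (V * seq A)%type.

Section Quiver.
Variables (V A : finType) (src tgt : A -> V).

Definition qvalid (p : qpath V A) : bool :=
  if p.2 is a :: s then (p.1 == src a) && path (fun x y => tgt x == src y) a s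
  else true.
Definition qsrc (p : qpath V A) : V := p.1.
Definition qtgt (p : qpath V A) : V := last p.1 (map tgt p.2).
Definition arrow_path (a : A) : qpath V A := (src a, [:: a]).
Definition vertex_path (v : V) : qpath V A := (v, [::]).

Definition quiver_connected : Prop :=
  forall u w : V, connect [rel x y | [exists a, ((src a == x) && (tgt a == y))
                                             || ((src a == y) && (tgt a == x))]] u w.

Variable Z : seq (qpath V A).

Definition minimal_relations : Prop :=
  (forall z, z \in Z -> qvalid z /\ (2 <= size z.2)%N) /\
  (forall z z', z \in Z -> z' \in Z -> infix z'.2 z.2 -> z' = z).

Definition containsZ (p : qpath V A) : bool := has (fun z => infix z.2 p.2) Z.
Definition inB (p : qpath V A) : bool := qvalid p && ~~ containsZ p.

(* Lambda = kQ/<Z> is finite dimensional, i.e. B is finite *)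
Definition fin_dim : Prop := exists N, forall p, inB p -> (size p.2 < N)%N.

Definition repl (p : qpath V A) (a : A) (g : qpath V A) : seq (qpath V A) :=
  [seq q <- [seq (p.1, take i p.2 ++ g.2 ++ drop i.+1 p.2)
            | i <- iota 0 (size p.2) & nth a p.2 i == a] | inB q].

Variable k : fieldType.

(* p^(a,g) as an element of kQ (coefficient function on paths) *)
Definition psubst (p : qpath V A) (a : A) (g : qpath V A) : qpath V A -> k :=
  fun eta => (count (pred1 eta) (repl p a g))%:R.

(* psi_1 (a, g) as an element of k(Z//B) (coefficient function on pairs) *)
Definition psi1 (a : A) (g : qpath V A) : qpath V A * qpath V A -> k :=
  fun pe => if pe.1 \in Z then psubst pe.1 a g pe.2 else 0.

(* L_{-1} = k(Q_1//Q_0) \cap Ker psi_1 = 0 ; an element of k(Q_1//Q_0) is  *)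
(* sum_a c_a (a, e_(src a)) with c supported on loops                      *)
Definition L_minus1_zero : Prop :=
  forall c : A -> k, (forall a, c a != 0 -> src a = tgt a) ->
  (forall pe, \sum_(a : A) c a * psi1 a (vertex_path (src a)) pe = 0) ->
  forall a, c a = 0.

Definition completely_saturated : Prop :=
  forall a b : A, src a = src b -> tgt a = tgt b ->
  forall p, p \in Z -> forall eta, psubst p b (arrow_path a) eta = 0.

(* The monomial algebra Lambda, realised on its basis B: elements are      *)
(* coefficient functions on paths supported on B, product = concatenation  *)
(* (zero if not composable or if the result contains an element of Z).     *)
Definition inL (f : qpath V A -> k) : Prop := forall p, ~~ inB p -> f p = 0.

Definition pleft (p : qpath V A) (i : nat) : qpath V A := (p.1, take i p.2).
Definition pright (p : qpath V A) (i : nat) : qpath V A :=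
  (last p.1 (map tgt (take i p.2)), drop i p.2).

Definition lmul (f g : qpath V A -> k) : qpath V A -> k :=
  fun p => if inB p then \sum_(i < (size p.2).+1) f (pleft p i) * g (pright p i)
           else 0.
Definition ladd (f g : qpath V A -> k) : qpath V A -> k := fun p => f p + g p.
Definition lscale (c : k) (f : qpath V A -> k) : qpath V A -> k := fun p => c * f p.

Definition endo := (qpath V A -> k) -> (qpath V A -> k).

Definition is_derivation (D : endo) : Prop :=
  [/\ forall f, inL f -> inL (D f),
      forall f g, inL f -> inL g -> D (ladd f g) = ladd (D f) (D g),
      forall c f, inL f -> D (lscale c f) = lscale c (D f)
    & forall f g, inL f -> inL g ->
        D (lmul f g) = ladd (lmul (D f) g) (lmul f (D g))].

Definition is_inner (D : endo) : Prop :=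
  exists2 x, inL x & forall f, inL f -> D f = ladd (lmul x f) (lscale (-1) (lmul f x)).

Definition HH1 : lieq k :=
  @LieQ k endo
    (fun D E f => ladd (D f) (E f))
    (fun c D f => lscale c (D f))
    (fun _ _ => 0)
    (fun D E f => ladd (D (E f)) (lscale (-1) (E (D f))))
    is_derivation is_inner.

End Quiver.

Section Classes.
Variables (V A : finType) (src tgt : A -> V).

Definition parclass (a : A) : {set A} :=
  [set b | (src b == src a) && (tgt b == tgt a)].

Definition pclass : finType := {S : {set A} | [exists a, S == parclass a]}.

(* the edge of (the underlying graph of) Qbar coming from class c joins u,w *)
Definition class_joins (c : pclass) (u w : V) : bool :=
  [exists a in val c, ((src a == u) && (tgt a == w)) || ((src a == w) && (tgt a == u))].

Definition qbar_connected : Prop :=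
  forall u w : V, connect [rel x y | [exists c, class_joins c x y]] u w.

Definition qbar_has_cycle : Prop :=
  exists n, exists (es : 'I_n -> pclass) (vs : 'I_n -> V),
    [/\ (0 < n)%N, injective es, injective vs
      & forall i, class_joins (es i) (vs i) (vs (ordS i))].

Definition qbar_is_tree : Prop := qbar_connected /\ ~ qbar_has_cycle.

Variable k : fieldType.

(* prod_{classes c} pgl(|c|, k) = (prod gl(|c|,k)) / (prod k*1) *)
Definition prod_pgl : lieq k :=
  @LieQ k (forall c : pclass, 'M[k]_(#|val c|))
    (fun X Y c => X c + Y c)
    (fun a X c => a *: X c)
    (fun c => 0)
    (fun X Y c => X c *m Y c - Y c *m X c)
    (fun _ => True)
    (fun X => forall c, exists a : k, X c = a%:M).

End Classes.

(* Main.v *)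
(* Modulo inner derivations every derivation preserves the length filtration of
   Lambda (this is L_(-1) = 0), so it has a matrix (M_D(a, b)) over pairs of
   parallel arrows: the coefficient of b in D(a).  Its entries vanish outside
   the preorder "(a, b) in Ker psi_1", and every matrix supported there comes
   from a derivation.

   If H^1 is semisimple, abelian ideals are inner.  Applied to the derivations
   raising length by m (descending induction on m) this makes every derivation
   with zero matrix inner; applied to the blocks from the complement of an
   up-set to that up-set it makes the preorder symmetric; applied to the
   diagonal matrices constant on the classes it yields, for each class
   function u, a potential t on vertices with u_a = t(source) - t(target).
   Taking u to be an indicator function shows that the classes of the preorder
   are those of parallelism and that Qbar has no cycle.  In characteristic 2
   the matrices supported on a class of two arrows, with equal diagonal
   entries, form one more abelian ideal.

   Conversely, cutting an edge of the tree gives such potentials over any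
   abelian group.  Over Q, with u = 1, they show that no path of length other
   than 1 is parallel to an arrow, whence D |-> M_D induces the isomorphism with
   the product of the pgl.  Finally an ideal of that product whose component
   in one pgl is nonzero contains all off-diagonal matrix units of that factor,
   and so do all its derived ideals. *)
Require Import Defs.
From mathcomp Require Import all_boot all_algebra.
From mathcomp Require Import zify ring.
From Stdlib Require Import FunctionalExtensionality.
Set Implicit Arguments.
Unset Strict Implicit.
Unset Printing Implicit Defensive.
Import GRing.Theory.

(** * The monomial algebra *)

Section PathAlgebra.
Local Open Scope ring_scope.
Variables (V A : finType) (src tgt : A -> V) (Z : seq (qpath V A)).
Variable k : fieldType.
Hypothesis Zmin : minimal_relations src tgt Z.

Local Notation P := (qpath V A).
Local Notation func := (P -> k).
Local Notation inB := (inB src tgt Z).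
Local Notation qvalid := (qvalid src tgt).
Local Notation inL := (inL src tgt Z).
Local Notation lmul := (lmul src tgt Z).
Local Notation pright := (pright tgt).

(** The class of the path [p] in Lambda. It is zero when [p] is not in B, so that identities such as
    [delta_cat] hold without case distinctions. *)
Definition delta (p : P) : func := fun q => (inB q && (q == p))%:R.

Lemma qvalid_cons v a s : qvalid (v, a :: s) = (v == src a) && qvalid (tgt a, s).
Proof. by rewrite /qvalid /=; case: s => //= b s; rewrite andbT. Qed.

Lemma qvalid_cat v s t :
  qvalid (v, s ++ t) = qvalid (v, s) && qvalid (last v (map tgt s), t).
Proof. by elim: s v => //= a s IH v; rewrite !qvalid_cons IH andbA. Qed.

Lemma containsZ_infix (p q : P) : infix p.2 q.2 -> containsZ Z p -> containsZ Z q.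
Proof.
move=> pq /hasP[z zZ zp]; apply/hasP; exists z => //.
exact: infix_trans zp pq.
Qed.

Lemma inB_valid q : inB q -> qvalid q. Proof. by case/andP. Qed.

Lemma inB_cat v s t :
  inB (v, s ++ t) -> inB (v, s) /\ inB (last v (map tgt s), t).
Proof.
case/andP; rewrite qvalid_cat => /andP[vs vt] nZ.
split; apply/andP; split=> //; apply: contra nZ; apply: containsZ_infix => /=.
  exact: prefixW (prefix_prefix _ _).
exact: suffixW (suffix_suffix _ _).
Qed.

Lemma inB_pleft q i : inB q -> inB (pleft q i).
Proof. by case: q => v s; rewrite -{1}(cat_take_drop i s) => /inB_cat[]. Qed.

Lemma inB_pright q i : inB q -> inB (pright q i).
Proof. by case: q => v s; rewrite -{1}(cat_take_drop i s) => /inB_cat[]. Qed.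

Lemma inB_short q : qvalid q -> (size q.2 < 2)%N -> inB q.
Proof.
move=> vq sq; rewrite /Defs.inB vq /=; apply/hasPn => z zZ.
apply/negP => /size_infix zq; have [/(_ z zZ)[_ sz] _] := Zmin.
by have:= leq_trans sz zq; rewrite leqNgt sq.
Qed.

Lemma inB_vertex v : inB (vertex_path A v).
Proof. exact: inB_short. Qed.

Lemma inB_arrow a : inB (arrow_path src a).
Proof. by apply: inB_short; rewrite //= /qvalid /= eqxx. Qed.

Lemma inB_cons v a s : inB (v, a :: s) -> v = src a /\ inB (tgt a, s).
Proof.
move=> h; have := inB_valid h; rewrite qvalid_cons => /andP[/eqP ->] _; split=> //.
by have [_] := @inB_cat v [:: a] s h.
Qed.

Lemma inB_size1 q : inB q -> size q.2 = 1%N -> exists a, q = arrow_path src a.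
Proof.
case: q => v [|a [|//]] //= h _; exists a.
by have [-> _] := inB_cons h.
Qed.

Lemma Z_notB p : p \in Z -> ~~ inB p.
Proof.
move=> pZ; rewrite negb_and negbK; apply/orP; right.
by apply/hasP; exists p => //; exact: infix_refl.
Qed.

Lemma lmul_out (f g : func) q : ~~ inB q -> lmul f g q = 0.
Proof. by rewrite /lmul /Defs.lmul => /negbTE ->. Qed.

Lemma lmul_inL (f g : func) : inL (lmul f g).
Proof. by move=> p; apply: lmul_out. Qed.

Lemma delta_inL p : inL (delta p).
Proof. by move=> q /negbTE; rewrite /delta => ->. Qed.

Lemma ladd_inL (f g : func) : inL f -> inL g -> inL (ladd f g).
Proof. by move=> hf hg q hq; rewrite /ladd hf ?hg ?addr0. Qed.

Lemma lscale_inL c (f : func) : inL f -> inL (lscale c f).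
Proof. by move=> hf q hq; rewrite /lscale hf ?mulr0. Qed.

Lemma delta_notB p : ~~ inB p -> delta p = fun=> 0.
Proof.
move=> h; apply: functional_extensionality => q; rewrite /delta.
by case: eqP => [->|_]; rewrite ?(negbTE h) ?andbF.
Qed.

Lemma lmul_delta_l v s (g : func) q :
  lmul (delta (v, s)) g q =
  if [&& inB q, q.1 == v & take (size s) q.2 == s] then g (pright q (size s)) else 0.
Proof.
rewrite /Defs.lmul; case: ifPn => //= hq.
have E i : delta (v, s) (pleft q i) = ((q.1 == v) && (take i q.2 == s))%:R.
  by rewrite /delta inB_pleft.
case: ifPn => [/andP[/eqP qv /eqP qs]|/negbTE nq].
  have ls : (size s < (size q.2).+1)%N by rewrite ltnS -qs size_take_min geq_minr.
  rewrite (bigD1 (Ordinal ls)) //= E qv qs !eqxx mul1r big1 ?addr0 // => i ni.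
  rewrite E; case: (take i q.2 =P s) => [ti|_]; last by rewrite andbF mul0r.
  case/eqP: ni; apply/val_inj => /=.
  by rewrite -ti size_takel // -ltnS ltn_ord.
apply: big1 => i _; rewrite E.
case: (take i q.2 =P s) => [ti|_]; last by rewrite andbF mul0r.
have si : size s = i by rewrite -ti size_takel // -ltnS ltn_ord.
by move: nq; rewrite si ti eqxx => ->; rewrite mul0r.
Qed.

(** If [s] is longer than [q], the truncated difference is 0 and the test compares [(v, s)] with all
    of [q], hence fails as it should. *)
Lemma lmul_delta_r v s (f : func) q :
  lmul f (delta (v, s)) q =
  if inB q && (pright q (size q.2 - size s) == (v, s))
  then f (pleft q (size q.2 - size s)) else 0.
Proof.
rewrite /Defs.lmul; case: ifPn => //= hq.
have E i : delta (v, s) (pright q i) = (pright q i == (v, s))%:R.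
  by rewrite /delta inB_pright.
case: ifPn => [qs|/negbTE nq].
  have ls : (size q.2 - size s < (size q.2).+1)%N by lia.
  rewrite (bigD1 (Ordinal ls)) //= E qs mulr1 big1 ?addr0 // => i ni.
  rewrite E; case: (pright q i =P (v, s)) => [[_ ti]|_]; last by rewrite mulr0.
  case/eqP: ni; apply/val_inj => /=.
  rewrite -ti size_drop subKn // -ltnS ltn_ord //.
apply: big1 => i _; rewrite E.
case: (pright q i =P (v, s)) => [[tv ti]|_]; last by rewrite mulr0.
have si : (size q.2 - size s = i)%N.
  by rewrite -ti size_drop subKn // -ltnS ltn_ord.
by move/eqP: nq; rewrite si /Defs.pright tv ti.
Qed.

Definition vtx v := delta (vertex_path A v).
Definition arr a := delta (arrow_path src a).

Lemma lmul_vtx_l v (g : func) q :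
  lmul (vtx v) g q = if inB q && (q.1 == v) then g q else 0.
Proof.
by rewrite lmul_delta_l take0 eqxx andbT /Defs.pright take0 drop0; case: q.
Qed.

Lemma lmul_vtx_r v (f : func) q :
  lmul f (vtx v) q = if inB q && (qtgt tgt q == v) then f q else 0.
Proof.
rewrite lmul_delta_r /= subn0 /Defs.pright /pleft take_size drop_size.
by rewrite /qtgt xpair_eqE eqxx andbT; case: q.
Qed.

Lemma lmul_arr_nil a (g : func) v : lmul (arr a) g (v, [::]) = 0.
Proof. by rewrite lmul_delta_l /= !andbF. Qed.

Lemma lmul_arr_cons a (g : func) v b s : inB (v, b :: s) ->
  lmul (arr a) g (v, b :: s) = (a == b)%:R * g (tgt b, s).
Proof.
move=> h; have [vb _] := inB_cons h.
rewrite lmul_delta_l h /Defs.pright /= take0 drop0 /= vb.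
rewrite eqseq_cons eqxx andbT (eq_sym b a).
by case: (a =P b) => [->|_]; rewrite ?eqxx ?andbF ?mul1r ?mul0r.
Qed.

Lemma delta_cat v s t :
  lmul (delta (v, s)) (delta (last v (map tgt s), t)) = delta (v, s ++ t).
Proof.
apply: functional_extensionality => q; rewrite lmul_delta_l.
have [hq|hq] := boolP (inB q); last by rewrite /delta (negbTE hq).
rewrite /delta hq inB_pright //= /Defs.pright.
case: q hq => w r hq /=; rewrite !xpair_eqE.
case: (w =P v) => //= ->.
case: (take (size s) r =P s) => [E|nE].
  by rewrite E eqxx /= -{2}(cat_take_drop (size s) r) E eqseq_cat // eqxx.
by case: (r =P s ++ t) => // E; case: nE; rewrite E take_size_cat.
Qed.

Lemma arr_cons a s : lmul (arr a) (delta (tgt a, s)) = delta (src a, a :: s).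
Proof. exact: (delta_cat (src a) [:: a] s). Qed.

Lemma lmulDl (f g h : func) : lmul (ladd f g) h = ladd (lmul f h) (lmul g h).
Proof.
apply: functional_extensionality => q; rewrite /ladd /Defs.lmul.
case: ifP => _; last by rewrite addr0.
by rewrite -big_split; apply: eq_bigr => i _; rewrite mulrDl.
Qed.

Lemma lmulDr (f g h : func) : lmul f (ladd g h) = ladd (lmul f g) (lmul f h).
Proof.
apply: functional_extensionality => q; rewrite /ladd /Defs.lmul.
case: ifP => _; last by rewrite addr0.
by rewrite -big_split; apply: eq_bigr => i _; rewrite mulrDr.
Qed.

Lemma lmulZl c (f h : func) : lmul (lscale c f) h = lscale c (lmul f h).
Proof.
apply: functional_extensionality => q; rewrite /lscale /Defs.lmul.
case: ifP => _; last by rewrite mulr0.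
by rewrite mulr_sumr; apply: eq_bigr => i _; rewrite mulrA.
Qed.

Lemma lmulZr c (f h : func) : lmul f (lscale c h) = lscale c (lmul f h).
Proof.
apply: functional_extensionality => q; rewrite /lscale /Defs.lmul.
case: ifP => _; last by rewrite mulr0.
by rewrite mulr_sumr; apply: eq_bigr => i _; rewrite mulrCA.
Qed.

(** The substitution i = j + l, where j and l are the lengths of the first two of the three factors
    in [lmulA]. *)
Lemma triangular_sum n (F : nat -> nat -> k) :
  \sum_(i < n.+1) \sum_(j < i.+1) F j (i - j)%N =
  \sum_(j < n.+1) \sum_(l < (n - j).+1) F j l.
Proof.
transitivity (\sum_(i < n.+1) \sum_(j < n.+1 | (j <= i)%N) F j (i - j)%N).
  apply: eq_bigr => i _.
  rewrite (big_ord_widen n.+1 (fun j => F j (i - j)%N)) ?ltn_ord //.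
rewrite (exchange_big_dep xpredT) //=; apply: eq_bigr => j _.
rewrite -(big_mkord (fun i => (j <= i)%N) (fun i => F j (i - j)%N)).
rewrite -(big_mkord xpredT (fun l => F j l)).
have jn : (j <= n.+1)%N by rewrite ltnW.
rewrite (big_cat_nat (n := j)) //= big_nat_cond big1 ?add0r; last by move=> i; lia.
rewrite -{1}(add0n j) big_addn subSn; last by rewrite -ltnS.
by apply: congr_big_nat => // i _; rewrite ?leq_addl ?addnK.
Qed.

Lemma lmulA (f g h : func) : lmul (lmul f g) h = lmul f (lmul g h).
Proof.
apply: functional_extensionality => q.
have [hq|hq] := boolP (inB q); last by rewrite !lmul_out.
pose F j l := f (pleft q j) * g (pleft (pright q j) l) * h (pright q (j + l)).
rewrite /Defs.lmul hq.
transitivity (\sum_(i < (size q.2).+1) \sum_(j < i.+1) F j (i - j)%N).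
  apply: eq_bigr => i _; rewrite inB_pleft // mulr_suml /=.
  rewrite size_takel -1?ltnS //; apply: eq_bigr => j _.
  have ji : (j <= i)%N by rewrite -ltnS.
  rewrite /F subnKC //; congr (_ * _ * _).
    by rewrite /pleft /= take_takel.
  by rewrite /Defs.pright /pleft /= take_takel // take_drop subnK.
rewrite triangular_sum; apply: eq_bigr => j _.
rewrite inB_pright //= mulr_sumr size_drop; apply: eq_bigr => l _.
rewrite /F -mulrA; congr (_ * (_ * h _)).
rewrite /Defs.pright /= drop_drop addnC; congr pair.
by rewrite addnC takeD map_cat last_cat.
Qed.

(** Bounded length leaves finitely many pairs of a vertex and a tuple of arrows. An explicit list of
    B later turns linearity of a derivation into a finite expansion. *)
Lemma finite_basis : fin_dim src tgt Z ->
  exists2 Bs : seq P, uniq Bs & forall p, (p \in Bs) = inB p.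
Proof.
case=> N hN.
pose l := flatten [seq [seq (v, tval t) | v <- enum V, t <- enum {: n.-tuple A}]
  | n <- iota 0 N].
exists (undup [seq p <- l | inB p]) => [|p]; first exact: undup_uniq.
rewrite mem_undup mem_filter; case hp: (inB p) => //=.
apply/flatten_mapP; exists (size p.2); first by rewrite mem_iota /= hN.
by apply/allpairsP; exists (p.1, in_tuple p.2); rewrite !mem_enum; case: p {hp}.
Qed.

End PathAlgebra.

(** * Derivations and their matrices *)

Section Derivations.
Local Open Scope ring_scope.
Variables (V A : finType) (src tgt : A -> V) (Z : seq (qpath V A)).
Variable k : fieldType.
Hypothesis Zmin : minimal_relations src tgt Z.

Local Notation P := (qpath V A).
Local Notation func := (P -> k).
Local Notation endo := (endo V A k).
Local Notation inB := (inB src tgt Z).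
Local Notation qvalid := (qvalid src tgt).
Local Notation inL := (inL src tgt Z).
Local Notation lmul := (lmul src tgt Z).
Local Notation pright := (pright tgt).
Local Notation delta := (delta src tgt Z k).
Local Notation vtx := (vtx src tgt Z k).
Local Notation arr := (arr src tgt Z k).
Local Notation deriv := (is_derivation src tgt Z).
Local Notation inner := (is_inner src tgt Z).
Local Notation vertex_path := (vertex_path A).
Local Notation arrow_path := (arrow_path src).

Implicit Types (D E : endo) (f g x : func).

Lemma der_zero D : deriv D -> D (fun=> 0) = fun=> 0.
Proof.
case=> _ _ DZ _.
have -> : (fun=> 0) = lscale 0 (fun=> 0) :> func.
  by apply: functional_extensionality => q; rewrite /lscale mul0r.
by rewrite DZ //; apply: functional_extensionality => q; rewrite /lscale !mul0r.
Qed.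

Lemma der_lmul D f g : deriv D -> inL f -> inL g ->
  forall q, D (lmul f g) q = lmul (D f) g q + lmul f (D g) q.
Proof. by case=> _ _ _ DM hf hg q; rewrite DM. Qed.

Lemma der_inL D f : deriv D -> inL f -> inL (D f).
Proof. by case=> h _ _ _; apply: h. Qed.

Lemma vtx_idem v : lmul (vtx v) (vtx v) = vtx v.
Proof. exact: (@delta_cat _ _ _ _ _ _ v [::] [::]). Qed.

Lemma src_arr a : lmul (vtx (src a)) (arr a) = arr a.
Proof. exact: (@delta_cat _ _ _ _ _ _ (src a) [::] [:: a]). Qed.

Lemma arr_tgt a : lmul (arr a) (vtx (tgt a)) = arr a.
Proof. exact: (@delta_cat _ _ _ _ _ _ (src a) [:: a] [::]). Qed.

Lemma eq_add_self0 (d : k) : d = d + d -> d = 0.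
Proof. by move=> h; apply: (addrI d); rewrite addr0. Qed.

(** The Leibniz rule for e_v e_v = e_v. Hence D(e_v) only involves paths with exactly one end at v:
    if both ends are v, the coefficient d satisfies d = d + d. *)
Lemma der_vtxE D v q : deriv D -> inB q ->
  D (vtx v) q = (qtgt tgt q == v)%:R * D (vtx v) q + (q.1 == v)%:R * D (vtx v) q.
Proof.
move=> dD hq; rewrite -{1}vtx_idem der_lmul //; try exact: delta_inL.
rewrite lmul_vtx_r lmul_vtx_l hq /=.
by case: eqP; case: eqP; rewrite ?mul1r ?mul0r.
Qed.

Lemma der_vtx_vertex D v w : deriv D -> D (vtx v) (vertex_path w) = 0.
Proof.
move=> dD; have := der_vtxE v dD (inB_vertex Zmin w); rewrite /qtgt /=.
by case: (w == v); rewrite ?mul1r ?mul0r ?addr0 // => /eq_add_self0.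
Qed.

Lemma der_arr_src D a q : deriv D -> inB q ->
  D (arr a) q = lmul (D (vtx (src a))) (arr a) q + (q.1 == src a)%:R * D (arr a) q.
Proof.
move=> dD hq; rewrite -{1}src_arr der_lmul //; try exact: delta_inL.
by rewrite lmul_vtx_l hq /=; case: eqP; rewrite ?mul1r ?mul0r.
Qed.

Lemma der_arr_tgt D a q : deriv D -> inB q ->
  D (arr a) q = (qtgt tgt q == tgt a)%:R * D (arr a) q + lmul (arr a) (D (vtx (tgt a))) q.
Proof.
move=> dD hq; rewrite -{1}arr_tgt der_lmul //; try exact: delta_inL.
by rewrite lmul_vtx_r hq /=; case: eqP; rewrite ?mul1r ?mul0r.
Qed.

(** A Leibniz term having [a] itself as a factor vanishes on a trivial path, so the projections onto
    the source and the target of [a] must both fix the coefficient. *)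
Lemma der_arr_vertex_par D a w : deriv D -> D (arr a) (vertex_path w) != 0 ->
  w = src a /\ w = tgt a.
Proof.
move=> dD nz; have hw := inB_vertex Zmin w.
have := der_arr_src a dD hw; have := der_arr_tgt a dD hw; move: nz.
rewrite lmul_arr_nil lmul_delta_r /Defs.pright /= xpair_eqE !andbF /qtgt /= add0r addr0.
by case: (w =P src a); case: (w =P tgt a); rewrite ?mul0r // => _ _ /eqP nz E1 E2.
Qed.

(** Iterated Leibniz rule. Since the length of [q] is fixed, the i-th arrow can only contribute
    through the segment of [q] of length [m] starting at position i, and the arrows around that
    segment must agree. The cases m = 0 and m = 1 are used. *)
Lemma der_path D v s q m a0 : deriv D -> s != [::] -> qvalid (v, s) -> inB q ->
  (size q.2).+1 = (size s + m)%N ->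
  D (delta (v, s)) q = \sum_(i < size s)
    ((take i q.2 == take i s) && (drop (i + m) q.2 == drop i.+1 s))%:R *
    D (arr (nth a0 s i)) (pright (pleft q (i + m)) i).
Proof.
move=> dD; elim: s v q => // a s IH v q _.
rewrite qvalid_cons => /andP[/eqP -> vs] hq sq.
case: s IH vs sq => [|b s] IH vs sq.
  rewrite big_ord1 /= take0 add0n eqxx.
  have qm : m = size q.2 by move: sq; rewrite add1n => -[].
  rewrite qm drop_size eqxx mul1r /Defs.pright /pleft /= take_size take0.
  by case: q {hq sq qm} => x t; rewrite /= ?drop0.
rewrite -arr_cons der_lmul; [|by []|exact: delta_inL..].
rewrite big_ord_recl.
congr (_ + _).
  rewrite lmul_delta_r hq /= take0 ?add0n eqxx ?drop0.
  have -> : (size q.2 - (size s).+1 = m)%N by move: sq; rewrite /=; lia.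
  rewrite /Defs.pright xpair_eqE [in RHS]/pleft /= take0 ?drop0 /=.
  have [E|] := drop m q.2 =P b :: s; last by rewrite andbF mul0r.
  have := inB_pright m hq; rewrite /Defs.pright E => /inB_cons[-> _].
  by move: vs; rewrite qvalid_cons => /andP[/eqP -> _]; rewrite eqxx mul1r.
case: q hq sq => w [|c r] hq sq; first by move: sq; rewrite /=; lia.
rewrite lmul_arr_cons //; have [_ hr] := inB_cons hq.
rewrite IH //; last by move: sq; rewrite /=; lia.
rewrite mulr_sumr; apply: eq_bigr => i _.
rewrite mulrA -natrM mulnb /= eqseq_cons (eq_sym c a) -!andbA.
congr (_%:R * D _ _).
Qed.

Lemma last_take v s i a0 : qvalid (v, s) -> (i < size s)%N ->
  last v (map tgt (take i s)) = src (nth a0 s i).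
Proof.
move=> vs hi; move: vs; rewrite -{1}(cat_take_drop i s) qvalid_cat (drop_nth a0) //.
by rewrite qvalid_cons => /andP[_ /andP[/eqP]].
Qed.

Lemma count_repl p a (g : P) e : inB e ->
  count (pred1 e) (repl src tgt Z p a g) =
  (\sum_(i < size p.2) ((nth a p.2 i == a) &&
     (e == (p.1, take i p.2 ++ g.2 ++ drop i.+1 p.2))))%N.
Proof.
move=> he; rewrite /repl count_filter count_map count_filter -sum1_count big_mkcond.
rewrite -{1}(subn0 (size p.2)) -/(index_iota 0 (size p.2)) big_mkord.
apply: eq_bigr => i _ /=; rewrite (eq_sym e).
case: (_ =P e) => [E|_] /=; last by rewrite andbF.
by rewrite andbT; case: eqP; rewrite // -/(Defs.inB _ _ _) E he.
Qed.

Hypothesis L0 : L_minus1_zero src tgt Z k.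

(* D annihilates the relations, and the part of D p = 0 of length |p| - 1, for p in
   Z, says that the degree -1 part of D lies in Ker psi_1. *)
Lemma der_arr_vertex D a w : deriv D -> D (arr a) (vertex_path w) = 0.
Proof.
move=> dD; pose c b := D (arr b) (vertex_path (src b)).
suff c0 : c a = 0.
  apply/eqP/negPn/negP => nz; have [wa _] := der_arr_vertex_par dD nz.
  by move: nz; rewrite wa -/(c a) c0 eqxx.
apply: L0 => {a w} [a ca|[[v s] e]].
  by have [] := der_arr_vertex_par dD ca.
have [pZ|pZ] := boolP ((v, s) \in Z); last first.
  by rewrite big1 // => a _; rewrite /psi1 /= (negbTE pZ) mulr0.
under eq_bigr => a _ do rewrite /psi1 /= pZ.
have [/(_ _ pZ)[/= vs ss] _] := Zmin.
have [he|he] := boolP (inB e); last first.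
  rewrite big1 // => a _; rewrite /psubst count_filter.
  rewrite (eq_count (a2 := pred0)) ?count_pred0 ?mulr0 // => q /=.
  by case: eqP => // ->; rewrite (negbTE he).
have [se|se] := (size e.2).+1 =P size s; last first.
  rewrite big1 // => a _; rewrite /psubst count_repl // big1 ?mulr0 // => i _.
  case: eqP => // _; case: eqP => //= E; case: se; rewrite E /= size_cat size_drop.
  by rewrite size_takel; case: i {E} => i /=; lia.
have a0 : A by case: (s) ss => [|a0].
have p0 : D (delta (v, s)) e = 0 by rewrite delta_notB ?der_zero // Z_notB.
rewrite -[RHS]p0 (der_path (m := 0) a0) ?addn0 //; last by case: (s) ss.
under eq_bigr => a _ do rewrite /psubst count_repl // natr_sum mulr_sumr.
(* Both sides are now sums over the positions of the relation and are compared term by term. *)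
rewrite exchange_big /=; apply: eq_bigr => i _.
rewrite (bigD1 (nth a0 s i)) //= big1 ?addr0 => [|a na]; last first.
  rewrite (set_nth_default a0) //; case: eqP => [E|_]; last by rewrite mulr0.
  by rewrite E eqxx in na.
rewrite (set_nth_default a0) // eqxx /= addn0 mulrC.
set a := nth a0 s i.
have -> : pright (pleft e i) i = vertex_path (last e.1 (map tgt (take i e.2))).
  by rewrite /Defs.pright /pleft /= take_takel // drop_oversize // size_take_min geq_minl.
have [ca|ca] := eqVneq (c a) 0.
  rewrite ca mulr0; apply/esym/eqP; rewrite mulf_eq0; apply/orP; right.
  apply/negPn/negP => nz; have [E _] := der_arr_vertex_par dD nz.
  by move: nz; rewrite E -/(c a) ca eqxx.
have [_ loop] := der_arr_vertex_par dD ca.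
have li : last v (map tgt (take i s)) = src a by apply: last_take.
case: e he se p0 => x t he se p0; rewrite /= in se *.
case: ((_ == _) && _) / idP => [|n1].
  case/andP=> /eqP ti /eqP di.
  have tE : t = take i s ++ drop i.+1 s by rewrite -ti -di cat_take_drop.
  have vt : qvalid (v, t).
    rewrite tE qvalid_cat; move: vs; rewrite -{1}(cat_take_drop i s) qvalid_cat.
    by rewrite li (drop_nth a0) // qvalid_cons -/a -loop => /and3P[-> _ ->].
  (* [t] is nonempty because relations have length at least 2, and its first arrow determines where
     the path starts. *)
  have xv : x = v.
    case: (t) (se) he vt => [|b r]; first by move=> E; rewrite -E in ss.
    by rewrite qvalid_cons => _ /inB_cons[-> _] /andP[/eqP].
  by rewrite xv ti li tE eqxx.
rewrite mul0r; case: eqP => [[_ E]|_]; last by rewrite mul0r.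
case: n1; rewrite E take_size_cat ?drop_size_cat ?eqxx // size_takel //.
  by rewrite ltnW.
by rewrite ltnW.
Qed.

(** Vertices and arrows generate Lambda, so the Leibniz rule along a path propagates the bound. For
    arrows it reads [m.+1] because an arrow has length 1. *)
Lemma der_raise m D : deriv D ->
  (forall v q, inB q -> (size q.2 < m)%N -> D (vtx v) q = 0) ->
  (forall a q, inB q -> (size q.2 < m.+1)%N -> D (arr a) q = 0) ->
  forall p q, qvalid p -> (size q.2 < size p.2 + m)%N -> D (delta p) q = 0.
Proof.
move=> dD Dv Da [v s] q; rewrite /=.
have [hq|hq] := boolP (inB q); last first.
  by move=> _ _; apply: (der_inL dD) hq; exact: delta_inL.
elim: s v q hq => [|a s IH] v q hq; first by move=> _; apply: Dv.
rewrite qvalid_cons => /andP[/eqP -> vs] sq.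
rewrite -arr_cons der_lmul; try exact: delta_inL; last by [].
rewrite lmul_delta_r; case: ifP => [/andP[_ /eqP[_ E]]|_]; last first.
  rewrite add0r; case: q hq sq => w [|c r] hq sq; first exact: lmul_arr_nil.
  by rewrite lmul_arr_cons // IH ?mulr0 //; have [] := inB_cons hq.
rewrite Da ?add0r ?inB_pleft //; last by rewrite /= size_take_min; move: sq; rewrite /=; lia.
case: q hq sq {E} => w [|c r] hq sq; first exact: lmul_arr_nil.
by rewrite lmul_arr_cons // IH ?mulr0 //; have [] := inB_cons hq.
Qed.

Definition raises m D :=
  forall p q, qvalid p -> (size q.2 < size p.2 + m)%N -> D (delta p) q = 0.

(** Lengths could only drop through an arrow producing a trivial path, which [der_arr_vertex]
    excludes. *)
Lemma der_raises0 D : deriv D -> raises 0 D.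
Proof.
move=> dD; apply: der_raise => // a [w s] _; rewrite ltnS leqn0 size_eq0 => /eqP /= ->.
exact: der_arr_vertex.
Qed.

(** The entry M_D(a, b). The first index is the argument of [D], so composing derivations multiplies
    these matrices in reverse order. *)
Definition acoef D a b : k := D (arr a) (arrow_path b).

Lemma der_raises1 D : deriv D -> (forall a b, acoef D a b = 0) -> raises 1 D.
Proof.
move=> dD D0; apply: der_raise => // [v|a] q hq.
  rewrite ltnS leqn0 size_eq0 => /eqP qe.
  by case: q qe {hq} => w s /= ->; apply: der_vtx_vertex.
rewrite ltnS leq_eqVlt => /predU1P[sq|].
  by have [b ->] := inB_size1 hq sq; apply: D0.
rewrite ltnS leqn0 size_eq0; case: q hq => w s _ /= /eqP ->.
exact: der_arr_vertex.
Qed.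

Definition parallel a b := (src a == src b) && (tgt a == tgt b).

Lemma acoef_parallel D a b : deriv D -> acoef D a b != 0 -> parallel a b.
Proof.
move=> dD nz; have hb := inB_arrow Zmin b.
have := der_arr_src a dD hb; rewrite lmul_delta_r hb /= -/(acoef D a b).
rewrite -/(vertex_path (src b)) der_vtx_vertex // if_same add0r.
have := der_arr_tgt a dD hb; rewrite lmul_arr_cons // -/(acoef D a b).
rewrite -/(vertex_path (tgt b)) der_vtx_vertex // mulr0 addr0 /qtgt /=.
rewrite /parallel (eq_sym (src b)) (eq_sym (tgt b)).
by case: eqP => _; case: eqP => _ //=; rewrite ?mul0r => E1 E2; case/eqP: nz.
Qed.

(* For a <> b this says that (a, b) lies in Ker psi_1. *)
Definition admissible a b :=
  parallel a b && all (fun p => nilp (repl src tgt Z p a (arrow_path b))) Z.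

(** Suppose that replacing some [a] in a relation p by [b] gives a path q in B. Since p and q differ
    at that position only, the coefficient of q in D(p) is exactly M_D(a, b); but D(p) = 0. *)
Lemma acoef_admissible D a b : deriv D -> acoef D a b != 0 -> admissible a b.
Proof.
move=> dD nz; rewrite /admissible (acoef_parallel dD nz) /=.
apply/allP => -[v s] pZ; apply/nilP/eqP/negPn/negP => ne.
have [q] : exists q, q \in repl src tgt Z (v, s) a (arrow_path b).
  by case: (repl _ _ _ _ _ _) ne => // q l _; exists q; rewrite mem_head.
rewrite mem_filter => /andP[hq] /mapP[i]; rewrite mem_filter mem_iota /= add0n.
case/andP=> /eqP ia hi qE; have {}ia : nth b s i = a by rewrite (set_nth_default a).
have [/(_ _ pZ)[/= vs ss] _] := Zmin.
(* Replacing [a] by itself would give back the relation, which is not in B. *)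
have ab : a != b.
  apply: contraL hq => /eqP ab; rewrite qE -ab -ia -drop_nth // cat_take_drop.
  exact: Z_notB.
have sti : size (take i s) = i by rewrite size_takel // ltnW.
have: D (delta (v, s)) q = 0 by rewrite delta_notB ?der_zero // Z_notB.
rewrite (der_path (m := 1) b) //; first last.
- by rewrite qE /= size_cat /= size_drop sti; lia.
- by case: (s) ss.
rewrite (bigD1 (Ordinal hi)) //= big1 ?addr0 => [|j ji].
  rewrite qE /= take_size_cat // eqxx /= addn1 -cat_rcons drop_size_cat ?size_rcons ?sti //.
  rewrite eqxx mul1r ia /Defs.pright /pleft /= take_size_cat ?size_rcons ?sti //.
  rewrite -cats1 take_size_cat // drop_size_cat // (last_take b) // ia.
  have /andP[/eqP -> _] := acoef_parallel dD nz.
  by move/eqP; rewrite (negbTE nz).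
(* A term at another position j would make [q] and the relation agree at i, where they carry [b] and
   [a]. *)
have nji : (j : nat) != i by apply: contraNneq ji => E; apply/eqP/val_inj.
case: eqP => [tj|]; last by rewrite mul0r.
case: eqP => [dj|]; last by rewrite mul0r.
suff: nth b q.2 i = nth b s i.
  rewrite qE ia /= nth_cat sti ltnn subnn /= => /esym/eqP.
  by rewrite (negbTE ab).
case: (ltngtP j i) nji => // ji' _.
  have E r : nth b r i = nth b (drop j.+1 r) (i - j.+1) by rewrite nth_drop subnKC.
  by rewrite [LHS]E [RHS]E -dj addn1.
by rewrite -(nth_take _ ji') tj nth_take.
Qed.

Variable Bs : seq (qpath V A).
Hypothesis Bs_uniq : uniq Bs.
Hypothesis mem_Bs : forall p, (p \in Bs) = inB p.

Lemma der_expand D f q : deriv D -> inL f ->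
  D f q = \sum_(p <- Bs) f p * D (delta p) q.
Proof.
move=> dD hf; have [_ DD DZ _] := dD.
have fE : f = fun r => \sum_(p <- Bs) f p * delta p r.
  apply: functional_extensionality => r; rewrite /delta.
  have [hr|hr] := boolP (inB r); last by rewrite hf // big1 // => p _; rewrite mulr0.
  rewrite (bigD1_seq r) ?mem_Bs //= eqxx mulr1 big1 ?addr0 // => p /negbTE np.
  by rewrite eq_sym np mulr0.
rewrite {1}fE; elim: Bs => [|p l IH].
  transitivity (D (fun=> 0) q); last by rewrite der_zero // big_nil.
  by congr (D _ q); apply: functional_extensionality => r; rewrite big_nil.
rewrite big_cons -IH.
have -> : (fun r => \sum_(p0 <- p :: l) f p0 * delta p0 r) =
  ladd (lscale (f p) (delta p)) (fun r => \sum_(p <- l) f p * delta p r).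
  by apply: functional_extensionality => r; rewrite big_cons.
rewrite DD ?DZ //; first exact: delta_inL.
  by apply: lscale_inL; exact: delta_inL.
by move=> r hr; rewrite big1 // => p' _; rewrite delta_inL ?mulr0.
Qed.

Lemma raises_comp m n D E : deriv D -> deriv E -> raises m D -> raises n E ->
  raises (m + n) (fun f => D (E f)).
Proof.
move=> dD dE rD rE p q vp sq.
rewrite der_expand //; last by apply: der_inL dE _; exact: delta_inL.
rewrite big_seq big1 // => r; rewrite mem_Bs => hr.
case: (ltnP (size r.2) (size p.2 + n)) => sr; first by rewrite rE ?mul0r.
rewrite rD ?mulr0 ?(inB_valid hr) //; apply: leq_trans sq _.
by rewrite (addnC m) addnA leq_add2r.
Qed.

Lemma sum_size1 (F : P -> k) : (forall p, inB p -> size p.2 != 1%N -> F p = 0) ->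
  \sum_(p <- Bs) F p = \sum_a F (arrow_path a).
Proof.
move=> F0; rewrite (bigID (fun p : P => size p.2 == 1%N)) /= addrC big_seq_cond big1.
  rewrite add0r -big_filter -[RHS]big_enum -(big_map arrow_path xpredT).
  apply: perm_big; apply: uniq_perm.
  - exact: filter_uniq.
  - by rewrite map_inj_uniq ?enum_uniq // => a b [].
  move=> p; rewrite mem_filter mem_Bs; apply/andP/mapP => [[/eqP sp hp]|[a _ ->]].
    by have [a ->] := inB_size1 hp sp; exists a; rewrite ?mem_enum.
  by split=> //; exact: inB_arrow.
by move=> p /andP[pB sp]; apply: F0; rewrite -?mem_Bs.
Qed.

(** In the expansion of E(a), trivial paths are absent by [der_arr_vertex], and paths of length at
    least 2 do not reach an arrow because [D] does not lower lengths. *)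
Lemma acoef_comp D E a b : deriv D -> deriv E ->
  acoef (fun f => D (E f)) a b = \sum_c acoef E a c * acoef D c b.
Proof.
move=> dD dE; rewrite /acoef der_expand //; last by apply: der_inL dE _; exact: delta_inL.
apply: sum_size1 => p hp; rewrite neq_ltn ltnS leqn0 size_eq0 => /orP[/eqP p0|sp].
  by case: p p0 hp => w _ /= -> _; rewrite der_arr_vertex // mul0r.
by rewrite der_raises0 ?mulr0 ?(inB_valid hp) // addn0.
Qed.

End Derivations.

(** * Derivations modulo inner derivations, and abelian ideals *)

Section LieStructure.
Local Open Scope ring_scope.
Variables (V A : finType) (src tgt : A -> V) (Z : seq (qpath V A)).
Variable k : fieldType.
Hypothesis Zmin : minimal_relations src tgt Z.
Variable Bs : seq (qpath V A).
Hypothesis Bs_uniq : uniq Bs.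
Hypothesis mem_Bs : forall p, (p \in Bs) = inB src tgt Z p.

Local Notation P := (qpath V A).
Local Notation func := (P -> k).
Local Notation endo := (endo V A k).
Local Notation inB := (inB src tgt Z).
Local Notation qvalid := (qvalid src tgt).
Local Notation inL := (inL src tgt Z).
Local Notation lmul := (lmul src tgt Z).
Local Notation pright := (pright tgt).
Local Notation delta := (delta src tgt Z k).
Local Notation vtx := (vtx src tgt Z k).
Local Notation arr := (arr src tgt Z k).
Local Notation deriv := (is_derivation src tgt Z).
Local Notation inner := (is_inner src tgt Z).
Local Notation vertex_path := (vertex_path A).
Local Notation arrow_path := (arrow_path src).

Implicit Types (D E : endo) (f g x : func).


Hypothesis Bfin : fin_dim src tgt Z.
Hypothesis L0 : L_minus1_zero src tgt Z k.

Local Notation acoef := (acoef src tgt Z).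
Local Notation parallel := (parallel src tgt).
Local Notation admissible := (admissible src tgt Z).
Local Notation raises := (raises src tgt Z).
Local Notation HH1 := (HH1 src tgt Z k).

Definition dzero : endo := fun _ _ => 0.
Definition dadd D E : endo := fun f => ladd (D f) (E f).
Definition dscale c D : endo := fun f => lscale c (D f).
Definition dsub D E : endo := dadd D (dscale (-1) E).
Definition brk D E : endo := fun f => ladd (D (E f)) (lscale (-1) (E (D f))).
Definition inn x : endo := fun f => ladd (lmul x f) (lscale (-1) (lmul f x)).

(** An [endo] acts on arbitrary coefficient functions, but being a derivation only depends on its
    values on Lambda. *)
Lemma der_ext D E : (forall f, inL f -> D f = E f) -> deriv E -> deriv D.
Proof.
move=> DE [E1 E2 E3 E4]; split=> [f hf|f g hf hg|c f hf|f g hf hg].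
- by rewrite DE //; apply: E1.
- by rewrite !DE ?E2 //; apply: ladd_inL.
- by rewrite !DE ?E3 //; apply: lscale_inL.
by rewrite !DE ?E4 //; apply: lmul_inL.
Qed.

Lemma der_dzero : deriv dzero.
Proof.
split=> // [f g _ _|c f _|f g _ _]; apply: functional_extensionality => q.
- by rewrite /ladd addr0.
- by rewrite /lscale mulr0.
rewrite /ladd /Defs.lmul; case: ifP => _; last by rewrite addr0.
by rewrite !big1 ?addr0 // => i _; rewrite /dzero ?mul0r ?mulr0.
Qed.

Lemma der_dadd D E : deriv D -> deriv E -> deriv (dadd D E).
Proof.
move=> [D1 D2 D3 D4] [E1 E2 E3 E4]; rewrite /dadd.
split=> [f hf|f g hf hg|c f hf|f g hf hg].
- by apply: ladd_inL; [apply: D1|apply: E1].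
- by rewrite D2 ?E2 //; apply: functional_extensionality => q; rewrite /ladd; ring.
- by rewrite D3 ?E3 //; apply: functional_extensionality => q; rewrite /ladd /lscale; ring.
rewrite D4 ?E4 // !lmulDl !lmulDr.
by apply: functional_extensionality => q; rewrite /ladd; ring.
Qed.

Lemma der_dscale c D : deriv D -> deriv (dscale c D).
Proof.
move=> [D1 D2 D3 D4]; rewrite /dscale.
split=> [f hf|f g hf hg|d f hf|f g hf hg].
- by apply: lscale_inL; apply: D1.
- by rewrite D2 //; apply: functional_extensionality => q; rewrite /ladd /lscale; ring.
- by rewrite D3 //; apply: functional_extensionality => q; rewrite /lscale; ring.
rewrite D4 // lmulZl lmulZr.
by apply: functional_extensionality => q; rewrite /ladd /lscale; ring.
Qed.

Lemma der_dsub D E : deriv D -> deriv E -> deriv (dsub D E).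
Proof. by move=> dD dE; apply: der_dadd => //; apply: der_dscale. Qed.

Lemma der_brk D E : deriv D -> deriv E -> deriv (brk D E).
Proof.
move=> [D1 D2 D3 D4] [E1 E2 E3 E4]; rewrite /brk.
have I := (@ladd_inL, @lscale_inL, @lmul_inL).
split=> [f hf|f g hf hg|d f hf|f g hf hg].
- by apply: ladd_inL; [|apply: lscale_inL]; auto.
- rewrite D2 // E2 // D2 ?E2; auto.
  by apply: functional_extensionality => q; rewrite /ladd /lscale; ring.
- rewrite D3 // E3 // D3 ?E3; auto.
  by apply: functional_extensionality => q; rewrite /ladd /lscale; ring.
rewrite D4 // E4 // D2 ?E2; try exact: lmul_inL.
rewrite !D4 ?E4; auto.
rewrite !lmulDl !lmulDr !lmulZl !lmulZr.
by apply: functional_extensionality => q; rewrite /ladd /lscale; ring.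
Qed.

Lemma der_inn x : inL x -> deriv (inn x).
Proof.
move=> hx; rewrite /inn; split=> [f hf|f g hf hg|d f hf|f g hf hg].
- by apply: ladd_inL; [|apply: lscale_inL]; apply: lmul_inL.
- rewrite !lmulDl !lmulDr.
  by apply: functional_extensionality => q; rewrite /ladd /lscale; ring.
- rewrite !lmulZl !lmulZr.
  by apply: functional_extensionality => q; rewrite /ladd /lscale; ring.
rewrite !lmulDl !lmulDr !lmulZl !lmulZr !lmulA.
by apply: functional_extensionality => q; rewrite /ladd /lscale; ring.
Qed.

Lemma inner_der D : inner D -> deriv D.
Proof. by case=> x hx DE; apply: der_ext DE _; apply: der_inn. Qed.

Lemma inner_inn x : inL x -> inner (inn x).
Proof. by move=> hx; exists x. Qed.

Lemma inner_ext D E : (forall f, inL f -> D f = E f) -> inner E -> inner D.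
Proof. by move=> DE [x hx Ex]; exists x => // f hf; rewrite DE ?Ex. Qed.

Lemma inner0 D : (forall f, inL f -> D f = fun=> 0) -> inner D.
Proof.
move=> D0; exists (fun=> 0) => // f hf; rewrite D0 //.
apply: functional_extensionality => q; rewrite /ladd /lscale /Defs.lmul.
case: ifP => _; last by rewrite mulr0 addr0.
by rewrite !big1 ?mulr0 ?addr0 // => i _; rewrite ?mul0r ?mulr0.
Qed.

Lemma inner_dadd D E : inner D -> inner E -> inner (dadd D E).
Proof.
case=> x hx Dx [y hy Ey]; exists (ladd x y); first exact: ladd_inL.
move=> f hf; rewrite /dadd Dx // Ey // lmulDl lmulDr.
by apply: functional_extensionality => q; rewrite /ladd /lscale; ring.
Qed.

Lemma inner_dscale c D : inner D -> inner (dscale c D).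
Proof.
case=> x hx Dx; exists (lscale c x); first exact: lscale_inL.
move=> f hf; rewrite /dscale Dx // lmulZl lmulZr.
by apply: functional_extensionality => q; rewrite /ladd /lscale; ring.
Qed.

Lemma inner_dsub_trans D E : inner (dsub D E) -> inner E -> inner D.
Proof.
move=> DE iE; apply: inner_ext (inner_dadd DE iE) => f hf.
by apply: functional_extensionality => q; rewrite /dsub /dadd /dscale /ladd /lscale; ring.
Qed.

(** [E, ad x] = ad E(x). *)
Lemma inner_brkr E D : deriv E -> inner D -> inner (brk E D).
Proof.
move=> dE [x hx Dx]; exists (E x); first exact: (der_inL dE).
have [E1 E2 E3 E4] := dE => f hf; rewrite /brk !Dx //; last exact: E1.
rewrite E2 ?E3 ?E4 //; try exact: lmul_inL; last by apply: lscale_inL; exact: lmul_inL.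
by apply: functional_extensionality => q; rewrite /ladd /lscale; ring.
Qed.

Lemma brkC E D : brk E D = dscale (-1) (brk D E).
Proof.
apply: functional_extensionality => f; apply: functional_extensionality => q.
by rewrite /brk /dscale /ladd /lscale; ring.
Qed.

Lemma inner_brkl E D : deriv D -> inner E -> inner (brk E D).
Proof. by move=> dD iE; rewrite brkC; apply/inner_dscale/inner_brkr. Qed.

Lemma acoef_dadd D E a b : acoef (dadd D E) a b = acoef D a b + acoef E a b.
Proof. by []. Qed.

Lemma acoef_dscale c D a b : acoef (dscale c D) a b = c * acoef D a b.
Proof. by []. Qed.

Lemma acoef_dsub D E a b : acoef (dsub D E) a b = acoef D a b - acoef E a b.
Proof. by rewrite acoef_dadd acoef_dscale mulN1r. Qed.

Lemma acoef_brk D E a b : deriv D -> deriv E -> acoef (brk D E) a b =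
  \sum_c (acoef E a c * acoef D c b - acoef D a c * acoef E c b).
Proof.
move=> dD dE; rewrite sumrB -!(acoef_comp Zmin L0 Bs_uniq mem_Bs) //.
by rewrite -mulN1r.
Qed.

Lemma acoef_inn x a b : acoef (inn x) a b =
  (a == b)%:R * (x (vertex_path (src a)) - x (vertex_path (tgt a))).
Proof.
rewrite /acoef /inn /ladd /lscale mulN1r lmul_arr_cons ?(inB_arrow Zmin) //.
rewrite lmul_delta_r (inB_arrow Zmin) /= /Defs.pright /= xpair_eqE eqseq_cons eqxx andbT.
rewrite (eq_sym b); case: (a =P b) => [->|_]; first by rewrite eqxx !mul1r.
by rewrite andbF !mul0r subr0.
Qed.

(** The shape of the matrix of an inner derivation: for ad x, the value of [t] at v is the
    coefficient of e_v in x. *)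
Definition is_potential (t : V -> k) D :=
  forall a b, acoef D a b = (a == b)%:R * (t (src a) - t (tgt a)).

Lemma acoef_inner D : inner D -> exists t, is_potential t D.
Proof.
case=> x hx Dx; exists (fun v => x (vertex_path v)) => a b.
by rewrite -acoef_inn /acoef Dx //; exact: delta_inL.
Qed.

Definition vfun (t : V -> k) : func := fun q => if q.2 is [::] then t q.1 else 0.

Lemma vfun_inL t : inL (vfun t).
Proof. by case=> v [|//] hv; rewrite (inB_vertex Zmin v) in hv. Qed.

Lemma acoef_vfun t : is_potential t (inn (vfun t)).
Proof. by move=> a b; rewrite acoef_inn. Qed.

Lemma inner_potential t D :
  (forall E, deriv E -> (forall a b, acoef E a b = 0) -> inner E) ->
  deriv D -> is_potential t D -> inner D.
Proof.
move=> H dD Dt; have iv := inner_inn (vfun_inL t).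
apply: (inner_dsub_trans _ iv); apply: H => [|a b].
  by apply: der_dsub => //; apply: inner_der.
by rewrite acoef_dsub Dt acoef_vfun subrr.
Qed.

(** The form in which semisimplicity is used. [R] is stable under brackets with derivations and
    abelian modulo inner derivations, so R + Inn is an ideal whose first derived ideal is zero in
    H^1. *)
Lemma abelian_ideal_inner (R : endo -> Prop) : lq_semisimple HH1 ->
  (forall D, R D -> deriv D) -> R dzero ->
  (forall D E, R D -> R E -> R (dadd D E)) ->
  (forall c D, R D -> R (dscale c D)) ->
  (forall E D, deriv E -> R D -> R (brk E D)) ->
  (forall D E, R D -> R E -> inner (brk D E)) ->
  forall D, R D -> inner D.
Proof.
move=> [_ ss] Rder R0 RD RZ Rbrk Rab D RDD.
pose J D := deriv D /\ exists2 D', R D' & inner (dsub D D').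
have IJ E : inner E -> J E.
  move=> iE; split; first exact: inner_der.
  exists dzero => //; apply: inner_ext iE => f _.
  apply: functional_extensionality => q.
  by rewrite /dsub /dadd /dscale /dzero /ladd /lscale; ring.
have RJ E : R E -> J E.
  move=> RE; split; first exact: Rder.
  exists E => //; apply: inner0 => f _; apply: functional_extensionality => q.
  by rewrite /dsub /dadd /dscale /ladd /lscale; ring.
apply: (ss J) (RJ _ RDD); last first.
  exists 1%N => E /(_ (@is_inner _ _ src tgt Z k)) h; apply: h => // [|D1 E1].
    split; [by apply: inner0|exact: inner_dadd|exact: inner_dscale].
  move=> [dD1 [D2 RD2 i12]] [dE1 [E2 RE2 j12]].
  have dD2 := Rder _ RD2; have dE2 := Rder _ RE2.
  have dd := inner_der i12; have de := inner_der j12.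
  (* [D1, E1] = [D1 - D2, E1] + [D2, E1 - E2] + [D2, E2]. The first two terms are inner because
     inner derivations form an ideal, the last one by the hypothesis on [R]. *)
  apply: (@inner_ext _ (dadd (dadd (brk (dsub D1 D2) E1) (brk D2 (dsub E1 E2)))
    (brk D2 E2))) => [f hf|]; last first.
    apply: inner_dadd (Rab _ _ RD2 RE2).
    by apply: inner_dadd; [exact: inner_brkl|exact: inner_brkr].
  have [h1 h2 h3 _] := dD2; have [l1 _ _ _] := dD1.
  have [g1 g2 g3 _] := dE1; have [k1 k2 k3 _] := dE2.
  rewrite /lq_br /= /brk /dsub /dadd /dscale.
  rewrite g2 ?g3 ?h2 ?h3; auto; try by apply: lscale_inL; auto.
  apply: functional_extensionality => q; rewrite /ladd /lscale; ring.
split.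
- split.
  + exact: RJ.
  + move=> D1 E1 [dD1 [D2 RD2 i12]] [dE1 [E2 RE2 j12]].
    split; first exact: der_dadd.
    exists (dadd D2 E2); first exact: RD.
    apply: inner_ext (inner_dadd i12 j12) => f _.
    apply: functional_extensionality => q.
    by rewrite /= /dsub /dadd /dscale /ladd /lscale; ring.
  + move=> c D1 [dD1 [D2 RD2 i12]]; split; first exact: der_dscale.
    exists (dscale c D2); first exact: RZ.
    apply: inner_ext (inner_dscale c i12) => f _.
    apply: functional_extensionality => q.
    by rewrite /= /dsub /dadd /dscale /ladd /lscale; ring.
- exact: IJ.
- by move=> E [].
move=> E D1 /= dE [dD1 [D2 RD2 i12]]; split; first exact: der_brk.
exists (brk E D2); first exact: Rbrk.
apply: inner_ext (inner_brkr dE i12) => f hf.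
have [g1 g2 g3 _] := dE; have [h1 _ _ _] := Rder _ RD2; have [k1 _ _ _] := dD1.
rewrite /= /brk /dsub /dadd /dscale g2 ?g3; auto; try by apply: lscale_inL; auto.
by apply: functional_extensionality => q; rewrite /ladd /lscale; ring.
Qed.

Lemma raises_dzero m : raises m dzero.
Proof. by []. Qed.

Lemma raises_dadd m D E : raises m D -> raises m E -> raises m (dadd D E).
Proof. by move=> rD rE p q vp sq; rewrite /dadd /ladd rD ?rE ?addr0. Qed.

Lemma raises_dscale m c D : raises m D -> raises m (dscale c D).
Proof. by move=> rD p q vp sq; rewrite /dscale /lscale rD ?mulr0. Qed.

Lemma raises_brk m n D E : deriv D -> deriv E -> raises m D -> raises n E ->
  raises (m + n) (brk D E).
Proof.
move=> dD dE rD rE; apply: raises_dadd.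
  exact: (raises_comp Bs_uniq mem_Bs dD dE).
by apply: raises_dscale; rewrite addnC; exact: (raises_comp Bs_uniq mem_Bs dE dD).
Qed.

Lemma raises_leq m n D : (n <= m)%N -> raises m D -> raises n D.
Proof.
move=> nm rD p q vp sq; apply: rD => //; apply: leq_trans sq _.
by rewrite leq_add2l.
Qed.

Lemma der_vanish D : deriv D -> (forall p q, inB p -> inB q -> D (delta p) q = 0) ->
  inner D.
Proof.
move=> dD D0; apply: inner0 => f hf; apply: functional_extensionality => q.
have [hq|hq] := boolP (inB q); last exact: (der_inL dD).
rewrite (der_expand Bs_uniq mem_Bs) // big_seq big1 // => p; rewrite mem_Bs => hp.
by rewrite D0 ?mulr0.
Qed.

(** Derivations raising lengths by m >= N vanish on B. For smaller m they form an ideal, and the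
    bracket of two of them raises lengths by 2m >= m + 1, hence is inner by the induction
    hypothesis. *)
Lemma semisimple_raises_inner D : lq_semisimple HH1 -> deriv D -> raises 1 D -> inner D.
Proof.
move=> ss dD rD; have [N hN] := Bfin.
suff H n m E : (0 < m)%N -> (N <= m + n)%N -> deriv E -> raises m E -> inner E.
  by apply: (H N 1%N); rewrite ?add1n.
elim: n m E => [|n IH] m E m0 Nm dE rE.
  apply: der_vanish => // p q hp hq; apply: rE; first exact: inB_valid hp.
  by apply: leq_trans (hN q hq) _; apply: leq_trans Nm _; rewrite addn0 leq_addl.
apply: (abelian_ideal_inner (R := fun E => deriv E /\ raises m E)) => //.
- by move=> ? [].
- by split; [exact: der_dzero|exact: raises_dzero].
- by move=> ? ? [? ?] [? ?]; split; [exact: der_dadd|exact: raises_dadd].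
- by move=> ? ? [? ?]; split; [exact: der_dscale|exact: raises_dscale].
- move=> E1 D1 dE1 [dD1 rD1]; split; first exact: der_brk.
   by rewrite -(add0n m); apply: raises_brk => //; exact: (der_raises0 Zmin L0).
move=> D1 E1 [dD1 rD1] [dE1 rE1]; apply: (IH m.+1) => //; first by rewrite addSnnS.
  exact: der_brk.
apply: (@raises_leq (m + m)); first by rewrite -addn1 leq_add2l.
exact: raises_brk.
Qed.

Lemma semisimple_acoef0_inner D : lq_semisimple HH1 -> deriv D ->
  (forall a b, acoef D a b = 0) -> inner D.
Proof.
move=> ss dD D0; apply: semisimple_raises_inner => //.
exact: (der_raises1 Zmin L0).
Qed.

End LieStructure.

(** * Derivations replacing arrows by parallel arrows *)

Section Replacement.
Local Open Scope ring_scope.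
Variables (V A : finType) (src tgt : A -> V) (Z : seq (qpath V A)).
Variable k : fieldType.
Hypothesis Zmin : minimal_relations src tgt Z.

Local Notation P := (qpath V A).
Local Notation func := (P -> k).
Local Notation endo := (endo V A k).
Local Notation inB := (inB src tgt Z).
Local Notation qvalid := (qvalid src tgt).
Local Notation inL := (inL src tgt Z).
Local Notation lmul := (lmul src tgt Z).
Local Notation pright := (pright tgt).
Local Notation delta := (delta src tgt Z k).
Local Notation vtx := (vtx src tgt Z k).
Local Notation arr := (arr src tgt Z k).
Local Notation deriv := (is_derivation src tgt Z).
Local Notation inner := (is_inner src tgt Z).
Local Notation vertex_path := (vertex_path A).
Local Notation arrow_path := (arrow_path src).

Implicit Types (D E : endo) (f g x : func).



Local Notation acoef := (acoef src tgt Z).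
Local Notation parallel := (parallel src tgt).
Local Notation admissible := (admissible src tgt Z).

Lemma parallel_refl a : parallel a a.
Proof. by rewrite /parallel !eqxx. Qed.

Lemma parallel_sym a b : parallel a b = parallel b a.
Proof. by rewrite /parallel (eq_sym (src a)) (eq_sym (tgt a)). Qed.

Lemma admissible_parallel a b : admissible a b -> parallel a b.
Proof. by case/andP. Qed.

Lemma qvalid_parallel v s a b t : parallel a b ->
  qvalid (v, s ++ a :: t) = qvalid (v, s ++ b :: t).
Proof.
case/andP => /eqP sab /eqP tab.
by rewrite !qvalid_cat !qvalid_cons sab tab.
Qed.

Lemma infix_middle (z s t : seq A) a : infix z (s ++ a :: t) ->
  [\/ infix z s, infix z t | exists z1 z2,
      [/\ z = z1 ++ a :: z2, suffix z1 s & prefix z2 t]].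
Proof.
case/infixP => u [w]; elim: u s => [|c u IH] s /=.
  move=> E; have [zs|sz] := leqP (size z) (size s).
    apply: Or31; have -> : z = take (size z) s.
      by rewrite -(takel_cat (a :: t) zs) E take_size_cat.
    exact: infix_take.
  apply: Or33; have zE : take (size s) z = s.
    by rewrite -(takel_cat w (ltnW sz)) -E take_size_cat.
  have := E; rewrite -(cat_take_drop (size s) z) zE -catA => /eqP.
  rewrite eqseq_cat // eqxx /=; case dz: (drop _ z) => [|c r].
    by have := size_drop (size s) z; rewrite dz /= => /esym/eqP; rewrite subn_eq0 leqNgt sz.
  by move=> /eqP[-> ->]; exists s, r; split=> //; rewrite ?suffix_refl ?prefix_prefix.
case: s => [|d s] /=.
  by case=> _ ->; apply: Or32; apply/infixP; exists u, w.
case=> _ /IH [h|h|[z1 [z2 [-> h1 h2]]]].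
- by apply: Or31; rewrite h orbT.
- exact: Or32.
apply: Or33; exists z1, z2; split=> //.
by apply: suffix_trans h1 _; rewrite -cat1s suffix_suffix.
Qed.

(** A relation inside s a t that avoids the marked [a] also lies inside s b t. One that contains it
    becomes, with [b] in place of [a], a subpath of s b t and so an element of B, against
    admissibility. *)
Lemma admissible_inB v s a b t : admissible a b ->
  inB (v, s ++ b :: t) -> inB (v, s ++ a :: t).
Proof.
case/andP=> ab adm /andP[vb nZ]; apply/andP; split.
  by rewrite (qvalid_parallel _ _ _ ab).
apply: contra nZ => /hasP[z zZ /=] /infix_middle[h|h|[z1 [z2 [zE h1 h2]]]].
- apply/hasP; exists z => //=; apply: infix_trans h _.
  exact: prefixW (prefix_prefix _ _).
- apply/hasP; exists z => //=; apply: infix_trans h _.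
  by rewrite -cat_rcons; exact: suffixW (suffix_suffix _ _).
have [/(_ _ zZ)[vz _] _] := Zmin.
apply/negPn/negP => nZ; have := allP adm _ zZ.
suff zR : (z.1, z1 ++ b :: z2) \in repl src tgt Z z a (arrow_path b).
  by case: (repl _ _ _ _ _ _) zR.
rewrite mem_filter; apply/andP; split.
  apply/andP; split.
    by rewrite -(qvalid_parallel _ _ _ ab) -zE; case: (z) vz.
  apply: contra nZ; apply: containsZ_infix => /=.
  case/suffixP: h1 => u ->; case/prefixP: h2 => w ->.
  by apply/infixP; exists u, w; rewrite -!catA.
apply/mapP; exists (size z1).
  by rewrite mem_filter mem_iota zE /= nth_cat ltnn subnn eqxx size_cat /= addnS ltnS leq_addr.
have dE : drop (size z1).+1 (z1 ++ a :: z2) = z2 by rewrite -cat_rcons drop_size_cat ?size_rcons.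
by rewrite zE take_size_cat // dE.
Qed.

Definition rset s i a : seq A := take i s ++ a :: drop i.+1 s.

Lemma size_rset s i a : (i < size s)%N -> size (rset s i a) = size s.
Proof. by move=> h; rewrite size_cat /= size_drop size_takel ?(ltnW h) //; lia. Qed.

Lemma take_rset_lt s i j a : (i < j)%N -> (j <= size s)%N ->
  take j (rset s i a) = rset (take j s) i a.
Proof.
move=> ij js; rewrite /rset take_cat size_takel; last by lia.
rewrite ltnNge (ltnW ij) /= take_takel 1?ltnW //; congr (_ ++ _).
rewrite -(subnSK ij) /= take_drop addnC subnKC //.
Qed.

Lemma drop_rset_lt s i j a : (i < j)%N -> (j <= size s)%N ->
  drop j (rset s i a) = drop j s.
Proof.
move=> ij js; rewrite /rset drop_cat size_takel; last by lia.
by rewrite ltnNge (ltnW ij) /= -(subnSK ij) /= drop_drop subnK.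
Qed.

Lemma take_rset_ge s i j a : (j <= i)%N -> (i < size s)%N ->
  take j (rset s i a) = take j s.
Proof.
move=> ji si; rewrite /rset takel_cat ?size_takel ?(ltnW si) //.
by rewrite take_takel.
Qed.

Lemma drop_rset_ge s i j a : (j + i < size s)%N ->
  drop j (rset s (j + i) a) = rset (drop j s) i a.
Proof.
move=> si; rewrite /rset drop_cat size_takel; last by lia.
case: i si => [|i] si.
  by rewrite addn0 ltnn subnn drop0 take0 drop_drop add1n.
rewrite ifT; last by lia.
by rewrite take_drop (addnC i.+1) drop_drop addSn (addnC i.+1).
Qed.

Lemma last_rset v s i a : (i < size s)%N -> tgt a = tgt (nth a s i) ->
  last v (map tgt (rset s i a)) = last v (map tgt s).
Proof.
move=> si ta; rewrite -[in RHS](cat_take_drop i s) (drop_nth a) //.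
by rewrite /rset !map_cat !last_cat /= ta.
Qed.

Lemma admissible_rset v s i a : inB (v, s) -> (i < size s)%N ->
  admissible a (nth a s i) -> inB (v, rset s i a).
Proof.
by move=> hq si adm; apply: admissible_inB adm _; rewrite -drop_nth // cat_take_drop.
Qed.

(* f is a coefficient function, so this is the endomorphism replacing one arrow a of
   a path by \sum_b M a b * b in all possible ways. *)
Definition dmat (M : A -> A -> k) : endo := fun f q =>
  if inB q then \sum_(i < size q.2) \sum_a M a (nth a q.2 i) * f (q.1, rset q.2 i a)
  else 0.

Section DerivationOfMatrix.
Variable M : A -> A -> k.
Hypothesis Madm : forall a b, M a b != 0 -> admissible a b.

(** A position lies to the left or to the right of the cut, which yields the two Leibniz terms. By
    admissibility the path with the replaced arrow stays in B, so [lmul] does not truncate it to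
    zero. *)
Lemma dmat_lmul f g q : inB q -> dmat M (lmul f g) q =
  lmul (dmat M f) g q + lmul f (dmat M g) q.
Proof.
case: q => v s hq; pose n := size s.
pose G j i := \sum_a M a (nth a s i) *
  (f (pleft (v, rset s i a) j) * g (pright (v, rset s i a) j)).
transitivity (\sum_(j < n.+1) \sum_(i < n) G j i).
  rewrite /dmat hq /= [RHS]exchange_big /=; apply: eq_bigr => i _.
  rewrite [RHS]exchange_big /=; apply: eq_bigr => a _.
  have [->|/Madm adm] := eqVneq (M a (nth a s i)) 0.
    by rewrite mul0r big1 // => j _; rewrite mul0r.
  by rewrite /Defs.lmul admissible_rset //= size_rset // mulr_sumr.
rewrite /Defs.lmul hq -big_split /=; apply: eq_bigr => j _.
have js : (j <= n)%N by rewrite -ltnS.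
rewrite -(big_mkord xpredT) (big_cat_nat (n := j)) //=; congr (_ + _).
  rewrite big_mkord /dmat inB_pleft //= size_takel // mulr_suml.
  apply: eq_bigr => i _; rewrite mulr_suml; apply: eq_bigr => a _.
  rewrite nth_take // -mulrA.
  have [->|/Madm adm] := eqVneq (M a (nth a s i)) 0; first by rewrite !mul0r.
  have /andP[_ /eqP ta] := admissible_parallel adm.
  congr (_ * (f _ * g _)); first by rewrite /pleft /= take_rset_lt.
  rewrite /Defs.pright /= take_rset_lt // drop_rset_lt // last_rset ?nth_take //.
  by rewrite size_takel.
rewrite -{1}(add0n j) big_addn big_mkord /dmat inB_pright //= size_drop mulr_sumr.
apply: eq_bigr => i _; rewrite mulr_sumr; apply: eq_bigr => a _.
have ijs : (j + i < n)%N by rewrite -ltn_subRL.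
rewrite nth_drop (addnC i) [RHS]mulrCA; congr (_ * (f _ * g _)).
  by rewrite /pleft /= take_rset_ge ?leq_addr.
by rewrite /Defs.pright /= take_rset_ge ?leq_addr // drop_rset_ge.
Qed.

Lemma der_dmat : deriv (dmat M).
Proof.
split=> [f _ q /negbTE hq|f g _ _|c f _|f g _ _]; first by rewrite /dmat hq.
- apply: functional_extensionality => q; rewrite /dmat /ladd.
  case: ifP => _; last by rewrite addr0.
  rewrite -big_split; apply: eq_bigr => i _; rewrite -big_split.
  by apply: eq_bigr => a _; rewrite mulrDr.
- apply: functional_extensionality => q; rewrite /dmat /lscale.
  case: ifP => _; last by rewrite mulr0.
  rewrite mulr_sumr; apply: eq_bigr => i _; rewrite mulr_sumr.
  by apply: eq_bigr => a _; rewrite mulrCA.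
apply: functional_extensionality => q; rewrite /ladd.
have [hq|hq] := boolP (inB q); first exact: dmat_lmul.
by rewrite !lmul_out // /dmat (negbTE hq) addr0.
Qed.

Lemma acoef_dmat a b : acoef (dmat M) a b = M a b.
Proof.
rewrite /acoef /dmat (inB_arrow Zmin) /= big_ord1 /= (bigD1 a) //= big1 => [|c ca].
  rewrite addr0 /arr /delta /rset /=.
  have [->|/Madm adm] := eqVneq (M a b) 0; first by rewrite mul0r.
  have /andP[/eqP sa _] := admissible_parallel adm.
  by rewrite -sa (inB_arrow Zmin) eqxx mulr1.
rewrite /arr /delta /rset /= xpair_eqE eqseq_cons (negbTE ca) !andbF.
by rewrite mulr0.
Qed.
End DerivationOfMatrix.

(** Replacing an arrow of a relation by itself returns the relation, which is not in B. *)
Lemma admissible_refl a : admissible a a.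
Proof.
rewrite /admissible parallel_refl; apply/allP => p pZ; rewrite /nilp size_filter.
rewrite -leqn0 leqNgt -has_count; apply/hasPn => q /mapP[i].
rewrite mem_filter mem_iota add0n => /andP[/eqP pia /= hi] ->.
rewrite -{1}pia -drop_nth // cat_take_drop.
by case: p pZ {pia hi} => v s; apply: Z_notB.
Qed.

Definition emat a b : A -> A -> k := fun c d => ((c == a) && (d == b))%:R.

Lemma emat_admissible a b c d : admissible a b -> emat a b c d != 0 -> admissible c d.
Proof.
by rewrite /emat; case: (c =P a) => [->|_]; case: (d =P b) => [->|_]; rewrite ?eqxx.
Qed.

Definition dgmat (u : A -> k) : A -> A -> k := fun c d => (c == d)%:R * u c.

Lemma dgmat_admissible u c d : dgmat u c d != 0 -> admissible c d.
Proof.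
rewrite /dgmat; case: (c =P d) => [->|_]; last by rewrite mul0r eqxx.
by rewrite admissible_refl.
Qed.

End Replacement.

(** * Consequences of semisimplicity *)

Section ParallelClasses.
Variables (V A : finType) (src tgt : A -> V).
Local Notation pclass := (pclass src tgt).
Local Notation parallel := (parallel src tgt).

Definition class_of a : pclass := Sub (parclass src tgt a)
  (introT existsP (ex_intro _ a (eqxx (parclass src tgt a)))).

Lemma mem_class_of a b : (b \in val (class_of a)) = parallel a b.
Proof. by rewrite SubK inE /parallel (eq_sym (src b)) (eq_sym (tgt b)). Qed.

Lemma class_ofP a (c : pclass) : a \in val c -> c = class_of a.
Proof.
case: c => S SP /= aS; apply/val_inj; rewrite SubK /=.
move: SP aS => /existsP[b /eqP ->]; rewrite inE => /andP[/eqP sa /eqP ta].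
by apply/setP => c; rewrite !inE sa ta.
Qed.

Lemma class_parallel a b (c : pclass) : a \in val c -> (b \in val c) = parallel a b.
Proof. by move/class_ofP ->; rewrite mem_class_of. Qed.

End ParallelClasses.

Section Semisimple.
Local Open Scope ring_scope.
Variables (V A : finType) (src tgt : A -> V) (Z : seq (qpath V A)).
Variable k : fieldType.
Hypothesis Zmin : minimal_relations src tgt Z.
Variable Bs : seq (qpath V A).
Hypothesis Bs_uniq : uniq Bs.
Hypothesis mem_Bs : forall p, (p \in Bs) = inB src tgt Z p.

Local Notation P := (qpath V A).
Local Notation func := (P -> k).
Local Notation endo := (endo V A k).
Local Notation inB := (inB src tgt Z).
Local Notation qvalid := (qvalid src tgt).
Local Notation inL := (inL src tgt Z).
Local Notation lmul := (lmul src tgt Z).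
Local Notation pright := (pright tgt).
Local Notation delta := (delta src tgt Z k).
Local Notation vtx := (vtx src tgt Z k).
Local Notation arr := (arr src tgt Z k).
Local Notation deriv := (is_derivation src tgt Z).
Local Notation inner := (is_inner src tgt Z).
Local Notation vertex_path := (vertex_path A).
Local Notation arrow_path := (arrow_path src).

Implicit Types (D E : endo) (f g : func).


Hypothesis Bfin : fin_dim src tgt Z.
Hypothesis L0 : L_minus1_zero src tgt Z k.

Local Notation acoef := (acoef src tgt Z).
Local Notation parallel := (parallel src tgt).
Local Notation admissible := (admissible src tgt Z).
Local Notation raises := (raises src tgt Z).
Local Notation HH1 := (HH1 src tgt Z k).


Local Notation dmat := (dmat src tgt Z).
Local Notation is_potential := (is_potential src tgt Z).
Local Notation brk := (@brk V A k).
Local Notation dzero := (@dzero V A k).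


Lemma sum_neq0 (I : finType) (F : I -> k) : \sum_i F i != 0 -> exists i, F i != 0.
Proof.
move=> nz; apply/existsP; apply: contraNT nz; rewrite negb_exists => /forallP F0.
by rewrite big1 // => i _; apply/eqP/negPn/F0.
Qed.

Lemma dgmat_offdiag (u : A -> k) a b : a != b -> dgmat u a b = 0.
Proof. by rewrite /dgmat => /negbTE ->; rewrite mul0r. Qed.

Lemma acoef_brk_neq0 D E c d : deriv D -> deriv E -> acoef (brk D E) c d != 0 ->
  exists e, (acoef E c e != 0 /\ acoef D e d != 0) \/
            (acoef D c e != 0 /\ acoef E e d != 0).
Proof.
move=> dD dE; rewrite (acoef_brk Zmin Bs_uniq mem_Bs L0) // => /sum_neq0[e nz].
exists e; have [z1|] := eqVneq (acoef E c e * acoef D e d) 0.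
  by right; move: nz; rewrite z1 sub0r oppr_eq0 mulf_eq0 negb_or => /andP.
by rewrite mulf_eq0 negb_or => /andP; left.
Qed.

Lemma not_inner_offdiag D a b : a != b -> acoef D a b != 0 -> ~ inner D.
Proof.
move=> ab nz /(acoef_inner Zmin)[t /(_ a b) E].
by move: nz; rewrite E (negbTE ab) mul0r eqxx.
Qed.

(** No combinatorics of relations is involved: the bracket of the derivations attached to the matrix
    units at (a, b) and (b, c) has entry 1 at (a, c), and nonzero entries of derivations are
    admissible. *)
Lemma admissible_trans b a c : admissible a b -> admissible b c -> admissible a c.
Proof.
move=> ab bc; have [->//|nab] := eqVneq a b.
pose D := dmat (emat k a b); pose E := dmat (emat k b c).
have dD : deriv D by apply: (der_dmat Zmin) => x y; apply: emat_admissible.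
have dE : deriv E by apply: (der_dmat Zmin) => x y; apply: emat_admissible.
have DE x y : acoef D x y = emat k a b x y.
  by apply: (acoef_dmat Zmin) => z t; apply: emat_admissible.
have EE x y : acoef E x y = emat k b c x y.
  by apply: (acoef_dmat Zmin) => z t; apply: emat_admissible.
apply: (acoef_admissible Zmin (D := brk E D)); first exact: der_brk.
rewrite (acoef_brk Zmin Bs_uniq mem_Bs L0) // (bigD1 b) //= big1 => [|e eb].
  by rewrite !DE !EE /emat !eqxx (negbTE nab) mul0r subr0 mulr1 addr0 oner_eq0.
by rewrite !DE !EE /emat (negbTE eb) (negbTE nab) !andbF !mul0r subr0.
Qed.

Hypothesis ss : lq_semisimple HH1.

Let acoef0_inner D : deriv D -> (forall a b, acoef D a b = 0) -> inner D.
Proof. exact: (semisimple_acoef0_inner Zmin Bs_uniq mem_Bs Bfin L0). Qed.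

(* With U the up-set of b, matrices mapping the complement of U to U form an
   abelian ideal. *)
Lemma semisimple_admissible_sym a b : admissible a b -> admissible b a.
Proof.
move=> ab; apply/negPn/negP => nba; pose U c := admissible b c.
pose R D := deriv D /\ forall c d, acoef D c d != 0 -> ~~ U c /\ U d.
have dD : deriv (dmat (emat k a b)).
  by apply: (der_dmat Zmin) => x y; apply: emat_admissible.
have DE x y : acoef (dmat (emat k a b)) x y = emat k a b x y.
  by apply: (acoef_dmat Zmin) => z t; apply: emat_admissible.
have nab : a != b by apply: contraNneq nba => ->; rewrite admissible_refl.
apply: (not_inner_offdiag (D := dmat (emat k a b)) nab).
  by rewrite DE /emat !eqxx oner_eq0.
apply: (abelian_ideal_inner (R := R)) => //.
- by move=> D [].
- by split; [exact: der_dzero|move=> c d; rewrite /acoef eqxx].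
- move=> D E [dD1 D1] [dE1 E1]; split; first exact: der_dadd.
  move=> c d; rewrite acoef_dadd; have [->|/D1 //] := eqVneq (acoef D c d) 0.
  by rewrite add0r; apply: E1.
- move=> x D [dD1 D1]; split; first exact: der_dscale.
  by move=> c d; rewrite acoef_dscale mulf_eq0 negb_or => /andP[_ /D1].
- move=> E D dE [dD1 D1]; split; first exact: der_brk.
  move=> c d /acoef_brk_neq0[] // e [[/D1[nc ue] /(acoef_admissible Zmin dE) ed]|].
    by split=> //; apply: admissible_trans ed.
  move=> [/(acoef_admissible Zmin dE) ce /D1[ne ud]]; split=> //.
  by apply: contra ne => uc; apply: admissible_trans ce.
- move=> D E [dD1 D1] [dE1 E1]; apply: acoef0_inner; first exact: der_brk.
  move=> c d; apply/eqP/negPn/negP => /acoef_brk_neq0[] // e.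
  by case=> [[/E1[_ ue] /D1[]]|[/D1[_ ue] /E1[]]]; rewrite ue.
split=> // c d; rewrite DE /emat.
case: (c =P a) => [->|_]; last by rewrite eqxx.
case: (d =P b) => [->|_]; last by rewrite eqxx.
by rewrite /U admissible_refl.
Qed.

(* These derivations are central modulo those with vanishing matrix. *)
Lemma semisimple_diag_inner D u : deriv D ->
  (forall a b, admissible a b -> u a = u b) ->
  (forall a b, acoef D a b = dgmat u a b) -> inner D.
Proof.
move=> dD uadm Du.
pose R D := deriv D /\ exists2 u, (forall a b, admissible a b -> u a = u b)
  & forall a b, acoef D a b = dgmat u a b.
(* The (c, d) entry is M_E(c, d) times the difference of the values of [u'] at d and c, and these
   values agree whenever M_E(c, d) is nonzero. *)
have brk0 E D' u' c d : deriv E -> deriv D' ->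
    (forall a b, admissible a b -> u' a = u' b) ->
    (forall a b, acoef D' a b = dgmat u' a b) -> acoef (brk E D') c d = 0.
  move=> dE dD' uadm' Du'; rewrite (acoef_brk Zmin Bs_uniq mem_Bs L0) // sumrB.
  rewrite (bigD1 c) //= big1 => [|e ec]; last first.
    by rewrite Du' dgmat_offdiag ?mul0r // eq_sym.
  rewrite (bigD1 d) //= big1 => [|e ec]; last by rewrite Du' dgmat_offdiag ?mulr0.
  rewrite !Du' /dgmat !eqxx !mul1r !addr0 mulrC -mulrBr.
  have [->|/(acoef_admissible Zmin dE) cd] := eqVneq (acoef E c d) 0.
    by rewrite mul0r.
  by rewrite (uadm' _ _ cd) subrr mulr0.
apply: (abelian_ideal_inner (R := R)) => //; last by split=> //; exists u.
- by move=> E [].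
- split; first exact: der_dzero.
  by exists (fun=> 0) => // a b; rewrite /acoef /dgmat mulr0.
- move=> E F [dE [u1 h1 e1]] [dF [u2 h2 e2]]; split; first exact: der_dadd.
  exists (fun a => u1 a + u2 a) => [a b ab|a b].
    by rewrite (h1 _ _ ab) (h2 _ _ ab).
  by rewrite acoef_dadd e1 e2 /dgmat mulrDr.
- move=> c E [dE [u1 h1 e1]]; split; first exact: der_dscale.
  exists (fun a => c * u1 a) => [a b ab|a b]; first by rewrite (h1 _ _ ab).
  by rewrite acoef_dscale e1 /dgmat mulrCA.
- move=> E D' dE [dD' [u1 h1 e1]]; split; first exact: der_brk.
  exists (fun=> 0) => // a b.
  by rewrite (brk0 _ _ _ _ _ dE dD' h1 e1) /dgmat mulr0.
move=> E F [dE _] [dF [u2 h2 e2]]; apply: acoef0_inner; first exact: der_brk.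
by move=> a b; apply: brk0 h2 e2.
Qed.

Lemma semisimple_potential u : (forall a b, admissible a b -> u a = u b) ->
  exists t : V -> k, forall a, u a = t (src a) - t (tgt a).
Proof.
move=> uadm; have dD : deriv (dmat (dgmat u)).
  by apply: (der_dmat Zmin) => x y; apply: dgmat_admissible.
have DE x y : acoef (dmat (dgmat u)) x y = dgmat u x y.
  by apply: (acoef_dmat Zmin) => z t; apply: dgmat_admissible.
have [t ht] := acoef_inner Zmin (semisimple_diag_inner dD uadm DE).
by exists t => a; have := ht a a; rewrite DE /dgmat eqxx !mul1r.
Qed.

(** Differences of a potential coincide on parallel arrows. Applied to the indicator of the arrows
    related to [a], which is 1 at [a], this forces the value 1 at [b]. *)
Lemma semisimple_admissible a b : parallel a b -> admissible a b.
Proof.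
move=> /andP[/eqP sab /eqP tab]; pose u c : k := (admissible a c)%:R.
have [t ht] : exists t : V -> k, forall a, u a = t (src a) - t (tgt a).
  apply: semisimple_potential => c d cd; congr (_%:R); congr nat_of_bool.
  apply/idP/idP => h; first exact: admissible_trans cd.
  exact: admissible_trans (semisimple_admissible_sym cd).
have : u a = u b by rewrite !ht sab tab.
rewrite /u admissible_refl //; case: (admissible a b) => // /eqP.
by rewrite oner_eq0.
Qed.

Lemma semisimple_saturated : completely_saturated src tgt Z k.
Proof.
move=> a b sab tab p pZ eta.
have /andP[_ /allP/(_ _ pZ)/nilP E] : admissible b a.
  by apply: semisimple_admissible; rewrite /parallel sab tab !eqxx.
by rewrite /psubst E.
Qed.

Lemma semisimple_class_potential u : (forall a b, parallel a b -> u a = u b) ->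
  exists t : V -> k, forall a, u a = t (src a) - t (tgt a).
Proof. by move=> h; apply: semisimple_potential => a b /admissible_parallel/h. Qed.

(** For [u] the indicator of one class of the cycle, the differences of the potential telescope to 0
    around the cycle; but they also add up to 1 or -1, since no other edge of the cycle has that
    class. *)
Lemma semisimple_acyclic : ~ qbar_has_cycle src tgt.
Proof.
case=> n [es [vs [n0 esI vsI js]]]; pose i0 := Ordinal n0.
pose u a : k := (a \in val (es i0))%:R.
have [a b ab|t ht] := semisimple_class_potential (u := u).
  congr (_%:R); congr nat_of_bool.
  by apply/idP/idP => h; rewrite (class_parallel _ h) // parallel_sym.
have S0 : \sum_i (t (vs i) - t (vs (ordS i))) = 0.
  rewrite sumrB [X in _ - X](_ : _ = \sum_i t (vs i)) ?subrr //.
  rewrite [RHS](reindex_inj (h := @ordS n)) //.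
  exact: can_inj (@ordSK n).
have D i : exists2 a, a \in val (es i) &
    (t (vs i) - t (vs (ordS i)) = u a) \/ (t (vs i) - t (vs (ordS i)) = - u a).
  have /existsP[a /andP[ai /orP[]/andP[/eqP s1 /eqP s2]]] := js i.
    by exists a => //; left; rewrite ht s1 s2.
  by exists a => //; right; rewrite ht s1 s2 opprB.
move: S0; rewrite (bigD1 i0) //= big1 => [|i ii].
  rewrite addr0; have [a ai [->|->]] := D i0; rewrite /u ai => /eqP.
    by rewrite oner_eq0.
  by rewrite oppr_eq0 oner_eq0.
have [a ai] := D i; have -> : u a = 0; last by case=> ->; rewrite ?oppr0.
rewrite /u; case: (boolP (a \in _)) => // a0.
by case/eqP: ii; apply: esI; rewrite (class_ofP ai) -(class_ofP a0).
Qed.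

(** If all classes were singletons, every derivation would have a diagonal matrix and be inner,
    whereas H^1 is nonzero. *)
Lemma semisimple_class2 : exists c : pclass src tgt, (2 <= #|val c|)%N.
Proof.
case: (boolP [exists c : pclass src tgt, 2 <= #|val c|]%N) => [/existsP //|].
rewrite negb_exists => /forallP small; exfalso.
have par_eq a b : parallel a b -> a = b.
  move=> ab; have := small (class_of src tgt a); rewrite -ltnNge ltnS.
  move/card_le1_eqP; apply; rewrite mem_class_of ?parallel_refl //.
have [[D [dD nD]] _] := ss; apply: nD.
apply: (semisimple_diag_inner (u := fun a => acoef D a a)) => // a b.
  by move/admissible_parallel/par_eq ->.
rewrite /dgmat; case: (a =P b) => [->|nab]; first by rewrite mul1r.
rewrite mul0r; apply/eqP/negPn/negP => /(acoef_parallel Zmin dD)/par_eq.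
exact: nab.
Qed.

(** On the class the commutator has trace 0, which in characteristic 2 means equal diagonal entries;
    this gives the ideal. The commutator of two of its members is scalar on the class, so the ideal
    is abelian, yet it contains the matrix unit at (a, b), which is not inner. *)
Lemma semisimple_char2 : (2%N \in [pchar k]) ->
  forall c : pclass src tgt, #|val c| != 2%N.
Proof.
move=> ch2 [S /= /existsP[x /eqP SE]]; apply/negP => /cards2P[a [b [nab Sab]]].
have memS c d : parallel c d -> (c \in S) = (d \in S).
  by rewrite SE !inE /parallel => /andP[/eqP -> /eqP ->].
have ab : parallel a b.
  have: a \in S by rewrite Sab !inE eqxx.
  have: b \in S by rewrite Sab !inE eqxx orbT.
  by rewrite SE !inE /parallel => /andP[/eqP -> /eqP ->] /andP[/eqP -> /eqP ->]; rewrite !eqxx.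
have aS : a \in S by rewrite Sab !inE eqxx.
have bS : b \in S by rewrite Sab !inE eqxx orbT.
pose R D := [/\ deriv D, forall c d, acoef D c d != 0 -> c \in S /\ d \in S
  & acoef D a a = acoef D b b].
have opp (y : k) : - y = y by apply: oppr_pchar2.
(* As [D] is supported on the class, the sum over all arrows reduces to [a] and [b]. *)
have RE D E c d : deriv E -> R D -> acoef (brk E D) c d =
    (acoef D c a * acoef E a d - acoef E c a * acoef D a d) +
    (acoef D c b * acoef E b d - acoef E c b * acoef D b d).
  move=> dE [dD D1 D2]; rewrite (acoef_brk Zmin Bs_uniq mem_Bs L0) //.
  rewrite (bigD1 a) //= (bigD1 b) 1?eq_sym //= big1 ?addr0 // => e /andP[ea eb].
  have eS : e \notin S by rewrite Sab !inE negb_or ea.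
  have -> : acoef D c e = 0 by apply/eqP/negPn/negP => /D1[_]; rewrite (negbTE eS).
  have -> : acoef D e d = 0 by apply/eqP/negPn/negP => /D1[]; rewrite (negbTE eS).
  by rewrite mul0r mulr0 subr0.
have RS E D c d : deriv E -> R D -> acoef (brk E D) c d != 0 -> c \in S /\ d \in S.
  move=> dE [dD D1 D2] /acoef_brk_neq0[] // e [[/D1[cS eS]]|[]].
    by move=> /(acoef_parallel Zmin dE)/memS <-.
  by move=> /(acoef_parallel Zmin dE)/memS -> /D1.
have Rbrk E D : deriv E -> R D -> R (brk E D).
  move=> dE RD; have [dD D1 D2] := RD.
  split; [exact: der_brk|by move=> c d; apply: RS|rewrite !RE //].
  rewrite D2 -[RHS]opp; ring.
have dM : deriv (dmat (emat k a b)).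
  by apply: (der_dmat Zmin) => y z; apply: emat_admissible; apply: semisimple_admissible.
have ME y z : acoef (dmat (emat k a b)) y z = emat k a b y z.
  by apply: (acoef_dmat Zmin) => z1 t; apply: emat_admissible; apply: semisimple_admissible.
apply: (not_inner_offdiag (D := dmat (emat k a b)) nab).
  by rewrite ME /emat !eqxx oner_eq0.
apply: (abelian_ideal_inner (R := R)) => //.
- by move=> D [].
- by split; [exact: der_dzero|move=> c d; rewrite /acoef eqxx|].
- move=> D E [dD D1 D2] [dE E1 E2]; split; first exact: der_dadd.
    move=> c d; rewrite acoef_dadd; have [->|/D1 //] := eqVneq (acoef D c d) 0.
    by rewrite add0r; apply: E1.
  by rewrite !acoef_dadd D2 E2.
- move=> y D [dD D1 D2]; split; first exact: der_dscale.
    by move=> c d; rewrite acoef_dscale mulf_eq0 negb_or => /andP[_ /D1].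
  by rewrite !acoef_dscale D2.
- move=> E D RE' RD; have [dE E1 E2] := RE'; have [dD D1 D2] := RD.
  have [dB B1 B2] := Rbrk E D dE RD.
  apply: (semisimple_diag_inner (u := fun c => if c \in S then acoef (brk E D) a a else 0)) => //.
    by move=> c d /admissible_parallel/memS ->.
  move=> c d; rewrite /dgmat.
  have [nz|] := eqVneq (acoef (brk E D) c d) 0; last first.
    move=> nz; have [cS dS] := B1 _ _ nz; rewrite cS; move: nz cS dS; rewrite Sab !inE.
    move=> nz /orP[]/eqP ec /orP[]/eqP ed; rewrite ec ed ?eqxx ?mul1r //.
      by case/eqP: nz; rewrite ec ed RE // D2 E2; ring.
    by case/eqP: nz; rewrite ec ed RE // D2 E2; ring.
  rewrite nz; case: (c =P d) nz => [->|_]; last by rewrite mul0r.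
  case: (boolP (d \in S)); last by rewrite mulr0.
  by rewrite Sab !inE => /orP[]/eqP -> ; rewrite ?B2 => ->; rewrite mulr0.
split=> // [c d|]; rewrite !ME /emat.
  case: (c =P a) => [->|_]; last by rewrite eqxx.
  case: (d =P b) => [->|_]; last by rewrite eqxx.
  by [].
by rewrite !eqxx (negbTE nab) eq_sym (negbTE nab).
Qed.

End Semisimple.

(** * The tree case *)

Section Acyclic.
Local Open Scope ring_scope.
Variables (V A : finType) (src tgt : A -> V).
Local Notation pclass := (pclass src tgt).
Local Notation parallel := (parallel src tgt).
Local Notation class_of := (class_of src tgt).
Local Notation class_joins := (@class_joins V A src tgt).

Lemma class_joins_sym c x y : class_joins c x y = class_joins c y x.
Proof. by rewrite /Defs.class_joins; apply: eq_existsb => a; rewrite orbC. Qed.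

Lemma class_joins_endpoints c x y z w : class_joins c x y -> class_joins c z w ->
  (x = z /\ y = w) \/ (x = w /\ y = z).
Proof.
move=> /existsP[a /andP[ac ja]] /existsP[b /andP[bc jb]]; move: ja jb.
have /andP[/eqP -> /eqP ->] : parallel a b by rewrite -(class_parallel _ ac).
by case/orP=> /andP[/eqP <- /eqP <-] /orP[]/andP[/eqP <- /eqP <-]; auto.
Qed.

Definition join_avoiding (c : pclass) : rel V :=
  [rel x y | [exists d : pclass, (d != c) && class_joins d x y]].

Lemma connect_avoiding_sym c : connect_sym (join_avoiding c).
Proof.
apply: sym_connect_sym => x y; apply: eq_existsb => d /=.
by rewrite class_joins_sym.
Qed.

Hypothesis acyclic : ~ qbar_has_cycle src tgt.

(** Otherwise a simple path from the target back to the source that avoids [c] closes up through [c]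
    to a cycle. A loop gives the empty path and a cycle of length one. *)
Lemma acyclic_bridge a (c : pclass) : a \in val c -> ~~ connect (join_avoiding c) (tgt a) (src a).
Proof.
move=> ac; apply/negP => /connectP[p0 path0].
case/shortenP: path0 => p pp up _ lastp; apply: acyclic.
pose n := size p; pose v i := nth (src a) (tgt a :: p) i.
(* The default [c] is never taken for i < n; the closing index n receives [c] separately. *)
pose e i := odflt c [pick d | (d != c) && class_joins d (v i) (v i.+1)].
have eP i : (i < n)%N -> e i != c /\ class_joins (e i) (v i) (v i.+1).
  move=> ip; rewrite /e; case: pickP => [d /andP[] //|none].
  have /existsP[d] := pathP (src a) pp i ip.
  by rewrite -[nth _ p i]/(v i.+1) -/(v i) => h; have := none d; rewrite h.
exists n.+1, (fun i => if (i < n)%N then e i else c), (fun i => v i); split=> //.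
(* An edge determines its two ends and the vertices are distinct. Matching the ends crosswise would
   give i = j + 1 and j = i + 1. *)
- have H (i j : 'I_n.+1) : (i < n)%N -> (j < n)%N -> e i = e j -> i = j.
    move=> ip jp eij; have [_ ji] := eP _ ip; have [_ jj] := eP _ jp.
    rewrite eij in ji; apply/val_inj => /=.
    have vI x y : (x <= n)%N -> (y <= n)%N -> v x = v y -> x = y.
      by move=> xn yn /eqP; rewrite nth_uniq // => /eqP.
    case: (class_joins_endpoints ji jj) => -[/vI E /vI E']; first by apply: E; exact: ltnW.
    by have := E (ltnW ip) jp; have := E' ip (ltnW jp); lia.
  move=> i j; case: ifP => ip; case: ifP => jp; first exact: H.
  + by move=> E; have [] := eP _ ip; rewrite E eqxx.
  + by move=> E; have [] := eP _ jp; rewrite -E eqxx.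
  by move=> _; apply/val_inj => /=; have := ltn_ord i; have := ltn_ord j; lia.
- move=> i j /eqP; rewrite nth_uniq // ?ltn_ord // => /eqP; exact: val_inj.
move=> i; case: ifP => ip.
  by rewrite /= modn_small //; have [] := eP _ ip.
have iE : (i : nat) = n by have := ltn_ord i; lia.
rewrite /= iE modnn {1}/v -last_nth -lastp /v /=.
by apply/existsP; exists a; rewrite ac !eqxx.
Qed.

(** Deleting the edge c separates its source from its target. The function [s c] is the value of [u]
    on the component of the source and 0 elsewhere, so its differences along arrows give [u] on the
    class c and 0 on every other class. *)
Lemma acyclic_potential (G : zmodType) (u : A -> G) :
  (forall a b, parallel a b -> u a = u b) ->
  exists t : V -> G, forall a, u a = t (src a) - t (tgt a).
Proof.
move=> upar.
pose s (c : pclass) v := if [pick a in val c] is Some a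
  then (if connect (join_avoiding c) (src a) v then u a else 0) else 0.
exists (fun v => \sum_c s c v) => b; rewrite -sumrB (bigD1 (class_of b)) //=.
rewrite big1 => [|c cb].
  rewrite addr0 /s; case: pickP => [a|/(_ b)]; last first.
    by rewrite mem_class_of parallel_refl.
  rewrite mem_class_of => ba; rewrite (upar _ _ ba).
  have /andP[/eqP sab _] := ba; rewrite -sab connect0.
  rewrite connect_avoiding_sym (negbTE (acyclic_bridge _)) ?subr0 //.
  by rewrite mem_class_of parallel_refl.
rewrite /s; case: pickP => [a _|_]; last exact: subrr.
have E : connect (join_avoiding c) (src b) (tgt b).
  apply: connect1; apply/existsP; exists (class_of b); rewrite eq_sym cb.
  by apply/existsP; exists b; rewrite mem_class_of parallel_refl !eqxx.
by rewrite (same_connect_r (connect_avoiding_sym c) E) subrr.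
Qed.

(* A potential for the constant function 1 counts the arrows of a path. *)
Lemma acyclic_parallel_path a v s : qvalid src tgt (v, s) ->
  v = src a -> last v (map tgt s) = tgt a -> size s = 1%N.
Proof.
(* Rational values determine the length itself, while values in [k] could only determine it modulo
   the characteristic. *)
move=> vs va ta; have [//|t ht] := @acyclic_potential rat (fun=> 1).
have H : t v - t (last v (map tgt s)) = (size s)%:R.
  elim: s v vs {va ta} => [|b s IH] v; first by rewrite subrr.
  rewrite qvalid_cons => /andP[/eqP -> vs] /=.
  by rewrite -add1n natrD -(IH _ vs) (ht b) addrA subrK.
move: H; rewrite va -va ta va -ht => /esym/eqP.
by rewrite -[1]/(1%:R) Num.Theory.eqr_nat => /eqP.
Qed.

End Acyclic.

(** * The isomorphism with the product of the pgl when Qbar has no cycle *)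

Section TreeCase.
Local Open Scope ring_scope.
Variables (V A : finType) (src tgt : A -> V) (Z : seq (qpath V A)).
Variable k : fieldType.
Hypothesis Zmin : minimal_relations src tgt Z.
Variable Bs : seq (qpath V A).
Hypothesis Bs_uniq : uniq Bs.
Hypothesis mem_Bs : forall p, (p \in Bs) = inB src tgt Z p.

Local Notation P := (qpath V A).
Local Notation func := (P -> k).
Local Notation endo := (endo V A k).
Local Notation inB := (inB src tgt Z).
Local Notation qvalid := (qvalid src tgt).
Local Notation inL := (inL src tgt Z).
Local Notation lmul := (lmul src tgt Z).
Local Notation pright := (pright tgt).
Local Notation delta := (delta src tgt Z k).
Local Notation vtx := (vtx src tgt Z k).
Local Notation arr := (arr src tgt Z k).
Local Notation deriv := (is_derivation src tgt Z).
Local Notation inner := (is_inner src tgt Z).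
Local Notation vertex_path := (vertex_path A).
Local Notation arrow_path := (arrow_path src).

Implicit Types (D E : endo) (f g : func).


Hypothesis Bfin : fin_dim src tgt Z.
Hypothesis L0 : L_minus1_zero src tgt Z k.

Local Notation acoef := (acoef src tgt Z).
Local Notation parallel := (parallel src tgt).
Local Notation admissible := (admissible src tgt Z).
Local Notation raises := (raises src tgt Z).
Local Notation HH1 := (HH1 src tgt Z k).


Local Notation dmat := (dmat src tgt Z).
Local Notation is_potential := (is_potential src tgt Z).
Local Notation brk := (@brk V A k).
Local Notation dzero := (@dzero V A k).



Lemma nth_rset (s : seq A) i a j a0 : (i < size s)%N ->
  nth a0 (rset s i a) j = if j == i then a else nth a0 s j.
Proof.
move=> si; rewrite nth_cat size_takel ?(ltnW si) //.
case: (ltngtP j i) => [ji|ij|->]; first by rewrite nth_take.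
  by rewrite -(subnSK ij) /= nth_drop subnKC.
by rewrite subnn.
Qed.

(** Saturation only says that the number of ways to obtain a path vanishes in [k]. For distinct
    arrows the resulting path determines the replaced position, so this number is at most 1 and must
    be 0. *)
Lemma saturated_admissible a b : completely_saturated src tgt Z k ->
  parallel a b -> admissible a b.
Proof.
move=> sat ab; have [->|nab] := eqVneq a b; first exact: admissible_refl.
rewrite /admissible ab; apply/allP => p pZ; apply/nilP.
case E: (repl _ _ _ _ _ _) => [//|q l]; exfalso.
have qr : q \in repl src tgt Z p a (arrow_path b) by rewrite E mem_head.
have /andP[/eqP sab /eqP tab] := ab.
have := sat b a (esym sab) (esym tab) p pZ q; rewrite /psubst.
move: qr; rewrite mem_filter => /andP[hq /mapP[i]].
rewrite mem_filter mem_iota add0n /= => /andP[/eqP pia hi] qE.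
rewrite count_repl // (bigD1 (Ordinal hi)) //= pia -qE !eqxx big1 => [/eqP|j ji].
  by rewrite addn0 oner_eq0.
case: eqP => //= pja; case: eqP => // qE'.
have := congr1 (fun q : P => nth a q.2 j) qE'; rewrite {1}qE /=.
rewrite -!/(rset _ _ _) !nth_rset // eqxx (negbTE (_ : (j : nat) != i)) ?pja.
  by move=> h; rewrite h eqxx in nab.
by apply: contraNneq ji => h; apply/eqP/val_inj.
Qed.

(* The element x = \sum_v D(e_v) e_v satisfies [x, e_v] = D(e_v). *)
Lemma acyclic_acoef0_inner D : ~ qbar_has_cycle src tgt -> deriv D ->
  (forall a b, acoef D a b = 0) -> inner D.
Proof.
move=> acyc dD D0.
pose x : func := fun q => D (vtx (qtgt tgt q)) q.
have xL : inL x by move=> q hq; apply: (der_inL dD) hq; exact: delta_inL.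
have iI := inner_inn xL; apply: (inner_dsub_trans _ iI).
have dE := der_dsub dD (inner_der iI); set E := dsub _ _ in dE *.
have Ev v q : inB q -> E (vtx v) q = 0.
  move=> hq; rewrite /E /dsub /dadd /dscale /inn /ladd /lscale.
  have Dq := der_vtxE v dD hq; rewrite lmul_vtx_l lmul_vtx_r hq /= /x.
  have [qv|nqv] := qtgt tgt q =P v.
    rewrite qv; case: (q.1 =P v) => [qs|_]; last by ring.
    by move: Dq; rewrite qv qs !eqxx !mul1r => /eq_add_self0 ->; ring.
  case: (q.1 =P v) => qv; last first.
    move: Dq; rewrite (introF eqP nqv) (introF eqP qv) !mul0r addr0 => ->; ring.
  (* For a path from v to w with w distinct from v, the Leibniz rule for e_v e_w = 0 shows that its
     coefficients in D(e_v) and D(e_w) are opposite. *)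
  have : D (lmul (vtx v) (vtx (qtgt tgt q))) q = 0.
    have -> : lmul (vtx v) (vtx (qtgt tgt q)) = fun=> 0.
      apply: functional_extensionality => r; rewrite lmul_vtx_l.
      case: ifP => // /andP[_ /eqP rv]; rewrite /vtx /delta.
      case: eqP => [rE|]; last by rewrite andbF.
      by case: nqv; rewrite -rv rE.
    by rewrite (der_zero dD).
  rewrite der_lmul ?lmul_vtx_l ?lmul_vtx_r ?hq ?qv ?eqxx //=; try exact: delta_inL.
  by move=> h; rewrite add0r !mulN1r opprK.
(* Since [E] kills the vertices, E(a) is supported on paths parallel to [a]. These are arrows by
   [acyclic_parallel_path], and their coefficients vanish too. *)
have Ea a q : inB q -> E (arr a) q = 0.
  move=> hq; apply/eqP/negPn/negP => nz.
  have E0 r : E (vtx r) = fun=> 0.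
    apply: functional_extensionality => s.
    have [/Ev //|hs] := boolP (inB s).
    by apply: (der_inL dE) hs; exact: delta_inL.
  have qs : q.1 = src a.
    apply/eqP; apply: contraNT nz => /negbTE qs; rewrite (der_arr_src a dE hq) qs mul0r addr0 E0.
    by rewrite lmul_delta_r; case: ifP.
  have qt : qtgt tgt q = tgt a.
    apply/eqP; apply: contraNT nz => /negbTE qs'; rewrite (der_arr_tgt a dE hq) qs' mul0r add0r E0.
    by rewrite lmul_delta_l; case: ifP.
  have sq : size q.2 = 1%N.
    apply: (acyclic_parallel_path acyc (a := a) (v := q.1)) => //.
    by have := inB_valid hq; case: (q).
  have [b qb] := inB_size1 hq sq; move: nz.
  rewrite qb -/(acoef E a b) acoef_dsub D0 (acoef_inn Zmin) /x.
  by rewrite !(der_vtx_vertex Zmin) // subrr mulr0 subrr eqxx.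
apply: (der_vanish Bs_uniq mem_Bs) => // p q hp hq.
(* [E] vanishes on all generators, so any m is allowed; this one is large enough to reach [q]. *)
apply: (der_raise (m := (size q.2).+1) dE) => //.
- by move=> *; apply: Ev.
- by move=> *; apply: Ea.
- exact: inB_valid hp.
by rewrite addnS ltnS leq_addl.
Qed.

Local Notation pclass := (pclass src tgt).

(** The transpose of a diagonal block of M_D: it undoes the reversal of products in [acoef_comp], so
    that brackets keep their order. *)
Definition class_matrix D (c : pclass) : 'M[k]_(#|val c|) :=
  \matrix_(i, j) acoef D (enum_val j) (enum_val i).

Lemma class_matrix_brk D E c : deriv D -> deriv E -> class_matrix (brk D E) c =
  class_matrix D c *m class_matrix E c - class_matrix E c *m class_matrix D c.
Proof.
move=> dD dE; apply/matrixP => i j; rewrite !mxE.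
rewrite (acoef_brk Zmin Bs_uniq mem_Bs L0) // sumrB.
have H F G : deriv F -> \sum_e acoef F (enum_val j) e * acoef G e (enum_val i) =
    \sum_l class_matrix G c i l * class_matrix F c l j.
  move=> dF; under [RHS]eq_bigr => l _ do rewrite !mxE mulrC.
  rewrite -(big_enum_val (fun e => acoef F (enum_val j) e * acoef G e (enum_val i))).
  rewrite [RHS]big_mkcond; apply: eq_bigr => e _; case: ifP => // ec.
  have -> : acoef F (enum_val j) e = 0; last by rewrite mul0r.
  apply/eqP/negPn/negP => /(acoef_parallel Zmin dF).
  by rewrite -(class_parallel _ (enum_valP j)) ec.
by rewrite !H.
Qed.

(** The inverse of [class_matrix]. Summing all entries against an indicator avoids transporting a
    component of [X] along an equality of classes. *)
Definition matrix_of_classes (X : forall c : pclass, 'M[k]_(#|val c|)) a b : k :=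
  \sum_c \sum_i \sum_j
    (X c i j *+ ((enum_val j == a) && (enum_val i == b))).

Lemma matrix_of_classes_parallel X a b : matrix_of_classes X a b != 0 -> parallel a b.
Proof.
apply: contraNT => nab; rewrite /matrix_of_classes big1 // => c _.
rewrite big1 // => i _; rewrite big1 // => j _; case: eqP => //= ja.
case: eqP => //= ib; case/negP: nab.
by rewrite -ja -ib -(class_parallel _ (enum_valP j)) enum_valP.
Qed.

Lemma matrix_of_classesE X c i j :
  matrix_of_classes X (enum_val j) (enum_val i) = X c i j.
Proof.
rewrite /matrix_of_classes (bigD1 c) //= [X in _ + X]big1 => [|d dc]; last first.
  rewrite big1 // => i' _; rewrite big1 // => j' _; case: eqP => //= E.
  case/eqP: dc; rewrite (class_ofP (enum_valP j')) E.
  by rewrite -(class_ofP (enum_valP j)).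
rewrite addr0 (bigD1 i) //= [X in _ + X]big1 => [|i' ii]; last first.
  by rewrite big1 // => j' _; rewrite (inj_eq enum_val_inj i') (negbTE ii) andbF.
rewrite addr0 (bigD1 j) //= [X in _ + X]big1 => [|j' jj]; last first.
  by rewrite (inj_eq enum_val_inj j') (negbTE jj).
by rewrite !eqxx addr0.
Qed.

Hypothesis acyc : ~ qbar_has_cycle src tgt.
Hypothesis sat : completely_saturated src tgt Z k.

Lemma tree_nonzero (c : pclass) : (2 <= #|val c|)%N -> lq_nonzero HH1.
Proof.
move=> /card_gt1P[a [b [ac bc nab]]].
have ab : admissible a b.
  by apply: saturated_admissible => //; rewrite -(class_parallel _ ac).
exists (dmat (emat k a b)); split.
  by apply: (der_dmat Zmin) => x y; apply: emat_admissible.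
apply: (not_inner_offdiag Zmin nab).
rewrite (acoef_dmat Zmin) => [|x y]; last exact: emat_admissible.
by rewrite /emat !eqxx oner_eq0.
Qed.

Lemma inner_class_matrix D c : inner D -> exists s, class_matrix D c = s%:M.
Proof.
case/(acoef_inner Zmin) => t ht.
have [a ac] : exists a, a \in val c.
  by have /existsP[a /eqP ->] := valP c; exists a; rewrite inE !eqxx.
exists (t (src a) - t (tgt a)); apply/matrixP => i j; rewrite !mxE ht.
rewrite (inj_eq enum_val_inj j) eq_sym; case: eqP => _; last by rewrite mul0r.
have := enum_valP j; rewrite (class_parallel _ ac) => /andP[/eqP -> /eqP ->].
by rewrite mul1r.
Qed.

(** The scalars form a class function, which has a potential because Qbar has no cycle. Subtracting
    the corresponding inner derivation leaves a derivation with zero matrix. *)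
Lemma class_matrix_inner D : deriv D ->
  (forall c, exists s, class_matrix D c = s%:M) -> inner D.
Proof.
move=> dD scal.
have entry a b : parallel a b -> exists s, acoef D a a = s /\ acoef D a b = s *+ (a == b)
    /\ acoef D b b = s.
  move=> ab; have [s /matrixP hs] := scal (class_of src tgt a).
  have ac : a \in val (class_of src tgt a) by rewrite mem_class_of parallel_refl.
  have bc : b \in val (class_of src tgt a) by rewrite mem_class_of.
  exists s; have := hs (enum_rank_in ac a) (enum_rank_in ac a).
  have := hs (enum_rank_in ac b) (enum_rank_in ac b).
  have := hs (enum_rank_in ac b) (enum_rank_in ac a).
  rewrite !mxE !enum_rankK_in // !eqxx => -> -> ->; split=> //; split=> //.
  rewrite (inj_in_eq (@enum_rank_in_inj _ _ _ _ ac ac)) //; by rewrite eq_sym.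
have [|t ht] := acyclic_potential acyc (u := fun a => acoef D a a).
  by move=> a b /entry[s [-> [_ ->]]].
apply: (inner_potential Zmin (t := t)) => // [E dE E0|a b].
  exact: acyclic_acoef0_inner.
rewrite -ht; have [ab|nab] := boolP (parallel a b).
  by have [s [-> [-> _]]] := entry _ _ ab; rewrite mulrC mulr_natr.
have -> : acoef D a b = 0.
  by apply/eqP/negPn/negP => /(acoef_parallel Zmin dD); apply/negP.
by case: eqP nab => [->|_ _]; rewrite ?parallel_refl // mul0r.
Qed.

Lemma tree_iso : lq_iso HH1 (prod_pgl src tgt k).
Proof.
have sub0 (X Y : forall c : pclass, 'M[k]_(#|val c|)) : (forall c, X c = Y c) ->
    lq_I (prod_pgl src tgt k) (lq_sub (prod_pgl src tgt k) X Y).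
  by move=> XY c; exists 0; rewrite /lq_sub /= XY scaleN1r subrr raddf0.
exists class_matrix; split=> //=.
- move=> D E dD dE; split=> [|s F dF]; apply: sub0 => c; apply/matrixP => i j.
    by rewrite !mxE.
  by rewrite !mxE.
- by move=> D E dD dE; apply: sub0 => c; apply: class_matrix_brk.
- move=> D dD; split; first exact: class_matrix_inner.
  by move=> iD c; apply: inner_class_matrix.
move=> X _; have adm a b : matrix_of_classes X a b != 0 -> admissible a b.
  by move/matrix_of_classes_parallel/(saturated_admissible sat).
exists (dmat (matrix_of_classes X)); first exact: (der_dmat Zmin).
apply: sub0 => c; apply/matrixP => i j.
by rewrite mxE (acoef_dmat Zmin) // matrix_of_classesE.
Qed.

End TreeCase.

(** * Semisimplicity of products of pgl *)

Section MatrixBrackets.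
Local Open Scope ring_scope.
Variables (k : fieldType) (n : nat).
Implicit Types X Y : 'M[k]_n.

Definition mxbr X Y := X *m Y - Y *m X.

Lemma mxbr_deltaE i j X a b :
  mxbr (delta_mx i j) X a b = (a == i)%:R * X j b - X a i * (b == j)%:R.
Proof.
rewrite !mxE (bigD1 j) //= big1 => [|l lj]; last first.
  by rewrite mxE (negbTE lj) andbF mul0r.
rewrite (bigD1 i) //= big1 => [|l li]; last by rewrite mxE (negbTE li) mulr0.
by rewrite !mxE !eqxx andbT !addr0.
Qed.

Lemma nonscalarP X : ~~ is_scalar_mx X ->
  (exists p q, p != q /\ X p q != 0) \/ (is_diag_mx X /\ exists p q, X p p != X q q).
Proof.
move=> ns; have [dX|] := boolP (is_diag_mx X); last first.
  case/existsP => p; rewrite negb_forall => /existsP[q].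
  by rewrite negb_imply => /andP[pq nz]; left; exists p, q.
right; split=> //; have [/existsP[p /existsP[q pq]]|] :=
  boolP [exists p, [exists q, X p p != X q q]]; first by exists p, q.
rewrite negb_exists => /forallP eqd; case/negP: ns; apply/is_scalar_mxP.
case: (posnP n) => [n0|n0].
  by exists 0; apply/matrixP => i; have := ltn_ord i; rewrite {2}n0.
pose i0 := Ordinal n0; exists (X i0 i0); apply/matrixP => i j; rewrite !mxE.
have := eqd i; rewrite negb_exists => /forallP/(_ i0); rewrite negbK => /eqP Xi.
case: (i =P j) => [<-|/eqP ij]; first by rewrite Xi.
by move/is_diag_mxP: dX => ->.
Qed.

(** Either 2 is invertible or a third index is available, which excludes size 2 in characteristic 2.
    The arguments below have one variant for each case. *)
Hypothesis room : (2%:R != 0 :> k) \/ forall p q : 'I_n, exists r, (r != p) && (r != q).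

(** Only multiples and brackets are available, so each matrix unit is reached as a multiple of a
    single iterated bracket starting from [X]. *)
Lemma bracket_closed_delta (T : 'M[k]_n -> Prop) X :
  (forall c Y, T Y -> T (c *: Y)) -> (forall M Y, T Y -> T (mxbr M Y)) ->
  T X -> ~~ is_scalar_mx X -> forall i j, i != j -> T (delta_mx i j).
Proof.
move=> TZ Tbr TX ns.
have unscale c Y M : c != 0 -> T M -> M = c *: Y -> T Y.
  by move=> c0 TM E; have := TZ c^-1 _ TM; rewrite E scalerA mulVf // scale1r.
have row i j l : T (delta_mx i j) -> l != j -> T (delta_mx l j).
  move=> Tij lj; suff -> : delta_mx l j = mxbr (delta_mx l i) (delta_mx i j) by apply: Tbr.
  apply/matrixP => a b; rewrite mxbr_deltaE !mxE !eqxx (negbTE lj) andbF mul0r subr0.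
  by rewrite -natrM mulnb.
have col i j l : T (delta_mx i j) -> l != i -> T (delta_mx i l).
  move=> Tij li; apply: (@unscale (-1) _ (mxbr (delta_mx j l) (delta_mx i j))).
  - by rewrite oppr_eq0 oner_eq0.
  - exact: Tbr.
  apply/matrixP => a b; rewrite mxbr_deltaE !mxE !eqxx (negbTE li) mulr0 sub0r andbT.
  by rewrite mulN1r -natrM mulnb.
(* Either [e_ji, [e_ji, e_ij]] = -2 e_ji, or the chain e_ij, e_ir, e_jr, e_ji. *)
have swap i j : i != j -> T (delta_mx i j) -> T (delta_mx j i).
  move=> ij Tij; case: room => [two|/(_ i j)[r /andP[ri rj]]]; last first.
    by apply: (col _ r) ij; apply: (row i); [apply: (col _ j)|rewrite eq_sym].
  apply: (@unscale (- 2%:R) _ (mxbr (delta_mx j i) (mxbr (delta_mx j i) (delta_mx i j)))).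
  - by rewrite oppr_eq0.
  - by apply/Tbr/Tbr.
  apply/matrixP => a b; rewrite !mxbr_deltaE !mxE !eqxx (negbTE ij) (eq_sym j) (negbTE ij).
  by rewrite ?andbT -!mulnb !natrM /=; ring.
suff [i [j [ij Tij]]] : exists i j, i != j /\ T (delta_mx i j).
  move=> p q pq; have [qi|qi] := eqVneq q i; last first.
    by apply: (row i) pq; apply: (col _ j).
  subst q; have [->|pj] := eqVneq p j; first exact: swap.
  by apply: (col _ j); [apply: (row i)|rewrite eq_sym].
(* For diagonal X, [e_pq, X] = (X_qq - X_pp) e_pq. If X_pq is nonzero off the diagonal, either
   [e_qp, [e_qp, X]] = -2 X_pq e_qp or [e_rr, [e_rp, [e_qq, X]]] = -X_pq e_rq. *)
case: (nonscalarP ns) => [[p [q [pq nz]]]|[/is_diag_mxP dX [p [q pq]]]]; last first.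
  have npq : p != q by apply: contraNneq pq => ->.
  exists p, q; split=> //; apply: (@unscale (X q q - X p p) _ (mxbr (delta_mx p q) X)).
  - by rewrite subr_eq0 eq_sym.
  - exact: Tbr.
  apply/matrixP => a b; rewrite mxbr_deltaE !mxE -mulnb natrM.
  have [->|ap] := eqVneq a p; have [->|bq] := eqVneq b q.
  - by rewrite /=; ring.
  - by rewrite (dX q b) 1?eq_sym // /=; ring.
  - by rewrite (dX a p) // /=; ring.
  - by rewrite /=; ring.
case: room => [two|/(_ p q)[r /andP[rp rq]]].
  exists q, p; split; first by rewrite eq_sym.
  apply: (@unscale (- 2%:R * X p q) _ (mxbr (delta_mx q p) (mxbr (delta_mx q p) X))).
  - by rewrite mulf_neq0 // oppr_eq0.
  - by apply/Tbr/Tbr.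
  apply/matrixP => a b; rewrite !mxbr_deltaE !mxE ?eqxx (negbTE pq) (eq_sym q) (negbTE pq).
  by rewrite ?andbT -!mulnb !natrM /=; ring.
exists r, q; split=> //.
apply: (@unscale (- X p q) _ (mxbr (delta_mx r r) (mxbr (delta_mx r p) (mxbr (delta_mx q q) X)))).
- by rewrite oppr_eq0.
- by apply/Tbr/Tbr/Tbr.
apply/matrixP => a b; rewrite !mxbr_deltaE !mxE ?eqxx (negbTE rp) (negbTE rq) (negbTE pq).
rewrite ?andbT -!mulnb !natrM; have [->|ar] := eqVneq a r; have [->|br] := eqVneq b r.
- by rewrite (negbTE rp) (negbTE rq) /=; ring.
- by rewrite (negbTE rq) /=; ring.
- by rewrite (negbTE rp) (negbTE rq) /=; ring.
- by rewrite /=; ring.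
Qed.

Lemma delta_bracket i j : i != j ->
  mxbr (delta_mx i j) (delta_mx j i) = delta_mx i i - delta_mx j j :> 'M[k]_n.
Proof. by move=> ij; rewrite /mxbr !mul_delta_mx. Qed.

(** The elements e_ij and e_ii - e_jj reproduce themselves under brackets: e_ii - e_jj =
    [e_ij, e_ji], and e_ij is either half of [e_ii - e_jj, e_ij] or [e_ir, e_rj]. *)
Lemma delta_in_derived (T T' : 'M[k]_n -> Prop) :
  (forall X Y, T X -> T Y -> T' (mxbr X Y)) -> (forall c Y, T' Y -> T' (c *: Y)) ->
  (forall i j, i != j -> T (delta_mx i j) /\ T (delta_mx i i - delta_mx j j)) ->
  forall i j, i != j -> T' (delta_mx i j) /\ T' (delta_mx i i - delta_mx j j).
Proof.
move=> TT' TZ TE i j ij; have ji : j != i by rewrite eq_sym.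
split; last first.
  by rewrite -delta_bracket //; apply: TT'; [case: (TE i j ij)|case: (TE j i ji)].
case: room => [two|/(_ i j)[r /andP[ri rj]]]; last first.
  have -> : delta_mx i j = mxbr (delta_mx i r) (delta_mx r j).
    by rewrite /mxbr mul_delta_mx mul_delta_mx_0 ?subr0 // eq_sym.
  by apply: TT'; [case: (TE i r); rewrite // eq_sym|case: (TE r j)].
have -> : delta_mx i j = 2%:R^-1 *: mxbr (delta_mx i i - delta_mx j j) (delta_mx i j) :> 'M[k]_n.
  rewrite /mxbr mulmxBl mulmxBr !mul_delta_mx !mul_delta_mx_0 // subr0 sub0r opprK.
  by rewrite -mulr2n -scaler_nat scalerA mulVf // scale1r.
by apply: TZ; apply: TT'; case: (TE i j ij).
Qed.

End MatrixBrackets.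

(** * Semisimplicity transported through the isomorphism *)

Section SemisimplePgl.
Local Open Scope ring_scope.
Variables (V A : finType) (src tgt : A -> V) (Z : seq (qpath V A)).
Variable k : fieldType.
Local Notation HH1 := (HH1 src tgt Z k).
Local Notation PGL := (prod_pgl src tgt k).
Local Notation endo := (endo V A k).
Local Notation deriv := (is_derivation src tgt Z).
Local Notation inner := (is_inner src tgt Z).
Local Notation pclass := (pclass src tgt).

(** Entries are addressed by arrows, so one formula defines all components at once and no cast
    between classes occurs. *)
Lemma prod_pgl_component (c : pclass) (Y : 'M[k]_#|val c|) :
  exists y : lq_car PGL, y c = Y.
Proof.
pose F a b := \sum_i \sum_j (Y i j *+ ((enum_val i == a) && (enum_val j == b))).
exists (fun d => \matrix_(i, j) F (enum_val i) (enum_val j)).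
apply/matrixP => i j; rewrite mxE /F (bigD1 i) //= [X in _ + X]big1 => [|i' ii].
  rewrite addr0 (bigD1 j) //= [X in _ + X]big1 => [|j' jj]; first by rewrite !eqxx addr0.
  by rewrite (inj_eq enum_val_inj j') (negbTE jj) andbF.
by rewrite big1 // => j' _; rewrite (inj_eq enum_val_inj i') (negbTE ii).
Qed.

Lemma pgl_iso_semisimple :
  lq_nonzero HH1 -> lq_iso HH1 PGL ->
  (2%N \in [pchar k] -> forall c : pclass, #|val c| != 2%N) ->
  lq_semisimple HH1.
Proof.
move=> nz [phi [_ lin br ker surj]] ch2; split=> // J [[J0 JD JZ] IJ JS Jbr] solv D JDD.
have addS D1 D2 : deriv D1 -> deriv D2 -> deriv (dadd D1 D2) by apply: der_dadd.
apply: (ker D (JS D JDD)).1 => c; apply/is_scalar_mxP/negPn/negP => ns.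
set n := #|val c| in ns *.
(* In characteristic 2 the size 2 is excluded, and size at most 1 would make every matrix scalar; so
   there are at least three indices. *)
have room : (2%:R != 0 :> k) \/ forall p q : 'I_n, exists r, (r != p) && (r != q).
  have [two|] := eqVneq (2%:R : k) 0; last by left.
  right=> p q; have n2 : n != 2%N by apply: ch2; rewrite inE /= two eqxx.
  have n1 : (1 < n)%N.
    rewrite ltnNge; apply: contra ns => n1; apply/is_scalar_mxP; exists (phi D c p p).
    apply/matrixP => i j; rewrite !mxE.
    have E (x : 'I_n) : x = p by apply/val_inj; have := ltn_ord x; have := ltn_ord p => /=; lia.
    by rewrite (E i) (E j) eqxx.
  have : (#|[set p; q]| < #|'I_n|)%N by rewrite card_ord cards2; case: (p != q); lia.
  rewrite ltnNge; have [/existsP[r]|] := boolP [exists r, r \notin [set p; q]].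
    by rewrite !inE negb_or => pqr _; exists r.
  rewrite negb_exists => /forallP all /negP[]; apply: subset_leq_card.
  by apply/subsetP => r _; have := all r; rewrite negbK.
(* The image of [W] in the factor at [c], modulo scalars. Working with preimages keeps the derived
   ideals on the side of H^1. *)
pose T W (Y : 'M[k]_n) := exists x, [/\ deriv x, W x & exists a, phi x c - Y = a%:M].
have subE (X Y : 'M[k]_n) : X + (-1) *: Y = X - Y by rewrite scaleN1r.
have TZ (W : endo -> Prop) a Y : (forall b x, W x -> W (dscale b x)) -> T W Y -> T W (a *: Y).
  move=> WZ [x [dx Wx [s hs]]]; exists (dscale a x); split; [exact: der_dscale|exact: WZ|].
  have [_ /(_ a x dx c)] := lin x x dx dx; rewrite /lq_sub /= subE => -[s1 hs1].
  exists (s1 + a * s); rewrite -(subrKA (a *: phi x c)) hs1 -scalerBr hs.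
  by rewrite raddfD /= scale_scalar_mx.
have Tbrk (W1 W2 W : endo -> Prop) X Y : (forall x y, deriv x -> W1 x -> W2 y -> W (brk x y)) ->
    T W1 X -> T W2 Y -> T W (mxbr X Y).
  move=> WW [x [dx Wx [s hs]]] [y [dy Wy [t ht]]]; exists (brk x y).
  split; [exact: der_brk|exact: WW|].
  have [s1 hs1] := br x y dx dy c; exists s1; rewrite -hs1 /lq_sub /= subE.
  congr (_ - _); have -> : phi x c = X + s%:M by rewrite -hs addrC subrK.
  have -> : phi y c = Y + t%:M by rewrite -ht addrC subrK.
  rewrite /mxbr !mulmxDl !mulmxDr !mul_scalar_mx !mul_mx_scalar.
  rewrite ?scale_scalar_mx; move: (X *m Y) (Y *m X) => XY YX.
  by apply/matrixP => i j; rewrite !mxE; ring.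
have TS Y : T (fun=> True) Y.
  have [y yc] := prod_pgl_component Y; have [x dx /(_ c)[s hs]] := surj y I.
  by exists x; split=> //; exists s; rewrite -hs /lq_sub /= yc subE.
have TJ i j : i != j -> T J (delta_mx i j) /\ T J (delta_mx i i - delta_mx j j).
  have TJbr M Y : T J Y -> T J (mxbr M Y).
    by apply: Tbrk (TS M) => x y dx _; apply: Jbr.
  have all : forall i j, i != j -> T J (delta_mx i j).
    apply: (@bracket_closed_delta _ _ room _ (phi D c)) => // [a Y|].
      by apply: TZ => b x; apply: JZ.
    by exists D; split=> //; [exact: JS|exists 0; rewrite subrr raddf0].
  move=> ij; split; first exact: all.
  by rewrite -delta_bracket //; apply: TJbr; apply: all; rewrite eq_sym.
have [N solvN] := solv.
have TN m : forall i j, i != j -> T (iter m (@lq_derived _ HH1) J) (delta_mx i j) /\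
    T (iter m (@lq_derived _ HH1) J) (delta_mx i i - delta_mx j j).
  elim: m => [|m IH]; first exact: TJ.
  apply: delta_in_derived IH => // [X Y|a Y].
    by apply: Tbrk => x y _ Wx Wy W _ _; apply.
  by apply: TZ => b x Wx W hW hI hbr; have [_ _] := hW; apply; apply: Wx.
(* [nonscalarP] provides distinct indices p and q. The unit e_pq comes, modulo scalars, from the
   N-th derived ideal, whose elements are inner and so have scalar image at [c]. *)
have /(nonscalarP)[[p [q [pq _]]]|[_ [p [q pq]]]] := ns.
  have [[x [dx /solvN ix [s hs]]] _] := TN N _ _ pq.
  have [t ht] := (ker x dx).2 ix c; move/matrixP/(_ p q): hs.
  rewrite ht !mxE !eqxx (negbTE pq) sub0r => /eqP.
  by rewrite oppr_eq0 oner_eq0.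
have {}pq : p != q by apply: contraNneq pq => ->.
have [[x [dx /solvN ix [s hs]]] _] := TN N _ _ pq.
have [t ht] := (ker x dx).2 ix c; move/matrixP/(_ p q): hs.
rewrite ht !mxE !eqxx (negbTE pq) sub0r => /eqP.
by rewrite oppr_eq0 oner_eq0.
Qed.

End SemisimplePgl.

(** * The equivalence of the three conditions *)

Lemma quiver_connected_qbar (V A : finType) (src tgt : A -> V) :
  quiver_connected src tgt -> qbar_connected src tgt.
Proof.
move=> conn u w; apply: connect_sub (conn u w) => x y /existsP[a ja]; apply: connect1.
apply/existsP; exists (class_of src tgt a); apply/existsP; exists a.
by rewrite mem_class_of parallel_refl.
Qed.

Theorem theorem3p15 (k : closedFieldType) (V A : finType) (src tgt : A -> V)
    (Z : seq (qpath V A)) :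
  quiver_connected src tgt ->
  minimal_relations src tgt Z ->
  fin_dim src tgt Z ->
  L_minus1_zero src tgt Z k ->
  let cond_ii :=
    [/\ qbar_is_tree src tgt,
        (exists c : pclass src tgt, 2 <= #|val c|)%N,
        completely_saturated src tgt Z k
      & ((2%N \in [pchar k])%R -> forall c : pclass src tgt, #|val c| != 2%N)] in
  let cond_iii :=
    [/\ lq_nonzero (HH1 src tgt Z k),
        lq_iso (HH1 src tgt Z k) (prod_pgl src tgt k)
      & ((2%N \in [pchar k])%R -> forall c : pclass src tgt, #|val c| != 2%N)] in
  (lq_semisimple (HH1 src tgt Z k) <-> cond_ii) /\ (cond_ii <-> cond_iii).
Proof.
move=> conn Zmin Bfin L0 cond_ii cond_iii.
have [Bs Bs_uniq mem_Bs] := finite_basis Bfin.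
have i_ii : lq_semisimple (HH1 src tgt Z k) -> cond_ii.
  move=> ss; split; last exact: (semisimple_char2 Zmin Bs_uniq mem_Bs Bfin L0 ss).
  - split; first exact: quiver_connected_qbar.
    exact: (semisimple_acyclic Zmin Bs_uniq mem_Bs Bfin L0 ss).
  - exact: (semisimple_class2 Zmin Bs_uniq mem_Bs Bfin L0 ss).
  exact: (semisimple_saturated Zmin Bs_uniq mem_Bs Bfin L0 ss).
have ii_iii : cond_ii -> cond_iii.
  case=> [[_ acyc] [c c2] sat ch2]; split=> //.
    exact: (tree_nonzero Zmin sat c2).
  exact: (tree_iso Zmin Bs_uniq mem_Bs L0 acyc sat).
have iii_i : cond_iii -> lq_semisimple (HH1 src tgt Z k).
  by case=> nz iso ch2; apply: pgl_iso_semisimple nz iso ch2.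
by split; split; auto.
Qed.
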